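(* Let $K$ be an infinite field with $\mathrm{char}(K)=2$ and let $Q\in\mathcal{Q}(n,d,m)$. If $h$ is a closed path in $Q$ with $h\not\equiv0$, then $\deg(h)\leq m(d-n-1)+2n$.
   Context: A quiver $Q$ is a finite oriented graph; for an arrow $a$, $a''$ is its tail and $a'$ its head. A path $a=a_1\cdots a_s$ ($a_i$ arrows) satisfies $a_i'=a_{i+1}''$; it is closed (in the vertex $a_1''$) if $a_1''=a_s'$; $\deg(a)=s$, $V(a)=\{a_1'',a_1',\dots,a_s'\}$. A closed path is primitive if each vertex of $V(a)$ is the head of exactly one $a_i$. $m(Q)$ is the maximal degree of a primitive closed path; $Q$ is strongly connected if some closed path contains all vertices; $\mathcal{Q}(n,d,m)$ is the set of strongly connected quivers with $n$ vertices, $d$ arrows and $m(Q)=m$. Closed paths are incident if they are closed in the same vertex. The equivalence $\equiv$ (for $\mathrm{char}(K)=2$) is the equivalence relation on the set of closed paths of $Q$ together with the symbol $0$ generated by: (1) $ab\equiv ba$ for paths $a,b$ such that $ab$ is a closed path; (2) $a_{\sigma(1)}\cdots a_{\sigma(t)}\equiv a_1\cdots a_t$ for incident closed paths $a_1,\dots,a_t$, $t\geq2$, $\sigma\in S_t$ (signs are irrelevant in characteristic 2); (3) $a_1^2a_2\equiv0$ for incident closed paths $a_1,a_2$; (4) $a_1^2\equiv0$ for every closed path $a_1$. *)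

(* Defs.v *)
From HB Require Import structures.
From mathcomp Require Import all_boot all_order all_algebra.
From Stdlib Require Import Relation_Operators.
Set Implicit Arguments. Unset Strict Implicit. Unset Printing Implicit Defensive.

Record quiver (n d : nat) := Quiver {
  qtail : 'I_d -> 'I_n;
  qhead : 'I_d -> 'I_n }.

Section Quiv.
Variables (n d : nat) (Q : quiver n d).

Definition is_qpath (p : seq 'I_d) : bool :=
  match p with
  | [::] => false
  | a :: s => path (fun x y => qhead Q x == qtail Q y) a s
  end.

Definition qdeg (p : seq 'I_d) : nat := size p.

Definition is_closed_path (p : seq 'I_d) : bool :=
  match p with
  | [::] => false
  | a :: s => is_qpath p && (qtail Q a == qhead Q (last a s))
  end.

Definition Vset (p : seq 'I_d) : seq 'I_n :=
  match p with
  | [::] => [::]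
  | a :: _ => qtail Q a :: map (qhead Q) p
  end.

Definition is_primitive (p : seq 'I_d) : bool :=
  is_closed_path p &&
  all (fun v => count (fun x => qhead Q x == v) p == 1) (Vset p).

Definition mQ_is (m : nat) : Prop :=
  (exists p, is_primitive p /\ qdeg p = m) /\
  (forall p, is_primitive p -> qdeg p <= m).

Definition strongly_connected : Prop :=
  exists p, is_closed_path p /\ forall v : 'I_n, v \in Vset p.

Definition incident (a b : seq 'I_d) : bool :=
  match a, b with
  | x :: _, y :: _ => qtail Q x == qtail Q y
  | _, _ => false
  end.

(* elements: Some p for a closed path p, None for the symbol 0 *)
Inductive equiv_gen : option (seq 'I_d) -> option (seq 'I_d) -> Prop :=
| eg_rot a b : is_qpath a -> is_qpath b -> is_closed_path (a ++ b) ->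
    equiv_gen (Some (a ++ b)) (Some (b ++ a))
| eg_perm (l l' : seq (seq 'I_d)) : 2 <= size l ->
    all is_closed_path l -> (forall a b, a \in l -> b \in l -> incident a b) ->
    perm_eq l l' ->
    equiv_gen (Some (flatten l')) (Some (flatten l))
| eg_sq2 a1 a2 : is_closed_path a1 -> is_closed_path a2 -> incident a1 a2 ->
    equiv_gen (Some (a1 ++ a1 ++ a2)) None
| eg_sq a1 : is_closed_path a1 -> equiv_gen (Some (a1 ++ a1)) None.

Definition qequiv : option (seq 'I_d) -> option (seq 'I_d) -> Prop :=
  clos_refl_sym_trans _ equiv_gen.

End Quiv.

Definition in_Qndm (n d : nat) (Q : quiver n d) (m : nat) : Prop :=
  strongly_connected Q /\ mQ_is Q m.

Definition infinite_type (T : eqType) : Prop :=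
  forall s : seq T, exists x, x \notin s.

(* Main.v *)
Require Import Defs.
From mathcomp Require Import all_boot all_order all_algebra.
From mathcomp Require Import zify.
From Stdlib Require Import Classical Relation_Operators.
Set Implicit Arguments. Unset Strict Implicit. Unset Printing Implicit Defensive.

(* A word is a sequence of consecutive arrows. Exchanging two adjacent closed
   factors generates an equivalence [eqv] of words; on closed words it is finer
   than the relation of the paper, so no word equivalent to a nonzero closed
   path contains the square of a nonempty closed path.

   The Kotzig-type theorem [rearrange] says that two words with the same ends
   and the same arrows are equivalent as soon as some primitive cycle passes
   through all their vertices and has all its arrows repeated. If every primitive
   factor of every word equivalent to [u] had all its arrows repeated in [u],
   this freedom would produce a square; hence a square-free word with a repeated
   vertex is equivalent to one containing a primitive cycle with an arrow that
   occurs only once ([private_cycle]).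

   Removing such a cycle [c] loses at least one arrow more than it loses
   vertices, and at most [m] letters, which is the slope of the bound. If the
   remaining word is not square-free it is equivalent to some [al k k be], and
   [c] can only be attached strictly inside [k]; one then removes both [c] and a
   copy of [k], and the vertices visited once, counted by [num_once], pay for the
   extra letters. Finally a closed path is cut open at an arrow that it uses only
   once. *)

Ltac lsolve := rewrite /= -?catA /= -?catA ?cats0 //=.
Ltac clia := clear; lia.
Ltac cnt := do 4 rewrite ?count_cat /=.

(** * Words, their vertices and the swap equivalence *)

Module Word.
Section Words.
Variables (V A : eqType) (tl hd : A -> V).
Implicit Types (x y v : V) (a b g : A) (u w p q c z : seq A).

(** Both ends are explicit, so the empty word is closed at every vertex and factors may be empty. *)
Fixpoint wpath x u y : bool :=
  if u is a :: u' then (tl a == x) && wpath (hd a) u' y else x == y.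

Lemma wpathP x u w y :
  reflect (exists2 v, wpath x u v & wpath v w y) (wpath x (u ++ w) y).
Proof.
elim: u x => [|a u IH] x /=.
  apply: (iffP idP) => [h|[v /eqP-> //]]; by exists x.
apply: (iffP andP) => [[ha /IH[v h1 h2]]|[v /andP[ha h1] h2]].
  by exists v => //; rewrite ha.
by split=> //; apply/IH; exists v.
Qed.

Lemma wpath_cat x v y u w : wpath x u v -> wpath v w y -> wpath x (u ++ w) y.
Proof. by move=> h1 h2; apply/wpathP; exists v. Qed.

Lemma wpath_end x u y y' : wpath x u y -> wpath x u y' -> y = y'.
Proof.
elim: u x => [|a u IH] x /=; first by move=> /eqP<- /eqP<-.
by case/andP=> _ h1 /andP[_ h2]; apply: IH h1 h2.
Qed.

Lemma wpath_start a x x' u w y y' : wpath x (a :: u) y -> wpath x' (a :: w) y' -> x = x'.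
Proof. by move=> /= /andP[/eqP<- _] /andP[/eqP<- _]. Qed.

Lemma wpath_catr x v y u w : wpath x u v -> wpath x (u ++ w) y -> wpath v w y.
Proof. by move=> h /wpathP[v' h1 h2]; rewrite (wpath_end h h1). Qed.

Lemma wpath_mid x y u a w : wpath x (u ++ a :: w) y -> wpath x u (tl a) /\ wpath (hd a) w y.
Proof. by case/wpathP=> v h1 /= /andP[/eqP -> h2]. Qed.

Lemma splitS u a : a \in u -> exists u1 u2, u = u1 ++ a :: u2.
Proof. by case/splitPr=> u1 u2; exists u1, u2. Qed.

Lemma cat_split (T : Type) (u1 u2 w1 w2 : seq T) :
  u1 ++ u2 = w1 ++ w2 -> size u1 <= size w1 -> exists e, w1 = u1 ++ e /\ u2 = e ++ w2.
Proof.
move=> h hs; exists (drop (size u1) w1).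
have h1 : take (size u1) w1 = u1 by rewrite -(@takel_cat _ _ w1 w2 hs) -h take_size_cat.
split; first by rewrite -[X in X ++ _]h1 cat_take_drop.
have := congr1 (drop (size u1)) h; rewrite drop_size_cat // drop_cat => ->.
case: ltnP => // hs'; have e : size w1 = size u1 by apply/eqP; rewrite eqn_leq hs' hs.
by rewrite e subnn drop0 -e drop_size.
Qed.

(** Visits with multiplicity: [uniq (verts x u)] fails for every nonempty closed word. *)
Definition verts x u := x :: map hd u.

Lemma vertsP x u y v : wpath x u y ->
  reflect (exists u1 u2, [/\ u = u1 ++ u2, wpath x u1 v & wpath v u2 y]) (v \in verts x u).
Proof.
move=> h; apply: (iffP idP) => [|[u1 [u2 [-> h1 h2]]]]; last first.
  elim: u1 x h1 {h} => [|a u1 IH] x /=; first by move=> /eqP->; rewrite /verts inE eqxx.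
  case/andP=> _ /IH; rewrite /verts !inE => /orP[/eqP->|->]; first by rewrite eqxx orbT.
  by rewrite !orbT.
elim: u x h => [|a u IH] x /=.
  move=> /eqP->; rewrite /verts mem_seq1 => /eqP->; exists [::], [::]; by rewrite /= eqxx.
case/andP=> ha h; rewrite /verts inE => /orP[/eqP->|hv].
  exists [::], (a :: u); by rewrite /= eqxx ha h.
have [u1 [u2 [-> h1 h2]]] := IH _ h hv.
by exists (a :: u1), u2; rewrite /= ha h1.
Qed.

Lemma vertsE x u y v : wpath x u y -> v \in verts x u ->
  exists u1 u2, [/\ u = u1 ++ u2, wpath x u1 v & wpath v u2 y].
Proof. by move=> h /(vertsP v h). Qed.

Lemma verts_cat x u v w y : wpath x u v -> wpath v w y ->
  verts x (u ++ w) = verts x u ++ map hd w.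
Proof. by rewrite /verts map_cat. Qed.

Lemma tl_verts x u y a : wpath x u y -> a \in u -> tl a \in verts x u.
Proof.
move=> h /splitS[u1 [u2 E]]; apply/(vertsP _ h); exists u1, (a :: u2).
move: h; rewrite E => h; have [h1 h2] := wpath_mid h; by rewrite h1 /= eqxx.
Qed.

Lemma hd_verts x u a : a \in u -> hd a \in verts x u.
Proof. by move=> h; rewrite /verts inE map_f ?orbT. Qed.

Inductive eqv u : seq A -> Prop :=
| eqv_refl : eqv u u
| eqv_swap v al p q be : eqv u (al ++ p ++ q ++ be) ->
    wpath v p v -> wpath v q v -> eqv u (al ++ q ++ p ++ be).

Lemma eqv_trans u w z : eqv u w -> eqv w z -> eqv u z.
Proof. by move=> h; elim=> // v al p q be _ h1; apply: eqv_swap. Qed.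

Lemma swapE v al p q be u w : wpath v p v -> wpath v q v ->
  u = al ++ p ++ q ++ be -> w = al ++ q ++ p ++ be -> eqv u w.
Proof. by move=> hp hq -> ->; apply: eqv_swap hp hq; apply: eqv_refl. Qed.

Lemma eqvE u w : u = w -> eqv u w.
Proof. by move=> ->; apply: eqv_refl. Qed.

Lemma eqv_sym u w : eqv u w -> eqv w u.
Proof.
elim=> [|v al p q be _ h hp hq]; first exact: eqv_refl.
by apply: eqv_trans h; apply: (swapE hq hp).
Qed.

Lemma eqv_perm u w : eqv u w -> perm_eq u w.
Proof.
elim=> // v al p q be _ h _ _; apply: perm_trans h _.
by rewrite perm_cat2l perm_catCA.
Qed.

Lemma eqv_size u w : eqv u w -> size u = size w.
Proof. by move=> /eqv_perm/perm_size. Qed.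

Lemma eqv_wpath x y u w : eqv u w -> wpath x u y -> wpath x w y.
Proof.
move=> h hu; elim: h => // v al p q be _ /wpathP[v1 h1] /wpathP[v2 h2] /wpathP[v3 h3 h4] hp hq.
case: p hp h2 => [|a p] hp h2.
  have e : v1 = v2 by apply/eqP. rewrite -e in h3.
  rewrite /=; apply: wpath_cat h1 _; exact: wpath_cat h3 h4.
have e := wpath_start hp h2; rewrite -e in h1 h2.
have e2 := wpath_end hp h2; rewrite -e2 in h3.
have e3 := wpath_end hq h3; rewrite -e3 in h4.
apply: wpath_cat h1 _; apply: wpath_cat hq _; exact: wpath_cat hp h4.
Qed.

Lemma eqv_cat al be u w : eqv u w -> eqv (al ++ u ++ be) (al ++ w ++ be).
Proof.
elim=> [|v al' p q be' _ h hp hq]; first exact: eqv_refl.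
by apply: eqv_trans h _; apply: (swapE (al := al ++ al') (be := be' ++ be) hp hq); lsolve.
Qed.

(** The form of being nonzero that makes sense for open words, hence for factors. *)
Definition nz u := forall al p be v, eqv u (al ++ p ++ p ++ be) -> wpath v p v -> p = [::].

Lemma nz_eqv u w : eqv u w -> nz u -> nz w.
Proof. by move=> h hn al p be v h1; apply: hn; apply: eqv_trans h h1. Qed.

Lemma nz_sub al u be : nz (al ++ u ++ be) -> nz u.
Proof.
move=> hn al' p be' v h hp; apply: (hn (al ++ al') p (be' ++ be) v) => //.
by apply: eqv_trans (eqv_cat al be h) _; apply: eqvE; lsolve.
Qed.

(** Between two visits to [v] the word is closed at [v], so it can be exchanged with [c]. *)
Lemma ins_same x v c u1 u2 w1 w2 : wpath v c v -> u1 ++ u2 = w1 ++ w2 ->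
  wpath x u1 v -> wpath x w1 v -> eqv (u1 ++ c ++ u2) (w1 ++ c ++ w2).
Proof.
move=> hc.
wlog hs : u1 u2 w1 w2 / size u1 <= size w1.
  move=> H e h1 h2; case: (leqP (size u1) (size w1)) => hs; first exact: H.
  by apply: eqv_sym; apply: H => //; exact: ltnW.
move=> e h1 h2; have [d [e1 e2]] := cat_split e hs.
rewrite {}e1 {}e2 in h2 *.
by apply: (swapE (al := u1) (be := w2) hc (wpath_catr h1 h2)); lsolve.
Qed.

(** Tails replace the heads of the usual definition; on a closed word the two lists are permutations
    of each other. *)
Definition prim v c := [&& c != [::], wpath v c v & uniq (map tl c)].
End Words.
End Word.
Import Word.

(** * Rearranging words around a primitive cycle with repeated arrows *)

Section Kotzig.
Variables (V A : eqType) (tl hd : A -> V).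
Implicit Types (x y v : V) (a b g : A) (u w p q c z : seq A).
Notation wpath := (wpath tl hd).
Notation eqv := (eqv tl hd).
Notation prim := (prim tl hd).

Lemma wpath_cons x a u y : wpath x (a :: u) y = (tl a == x) && wpath (hd a) u y.
Proof. by []. Qed.

(** Tails being distinct, only one arrow can follow at each vertex. *)
Lemma path_uniq x d d' y y' : wpath x d y -> wpath x d' y' -> perm_eq d d' ->
  uniq (map tl d) -> d = d'.
Proof.
elim: d x d' => [|a d IH] x d'; first by move=> _ _ /perm_size; case: d'.
case: d' => [|a' d']; first by move=> _ _ /perm_size.
move=> /= /andP[/eqP ha h] /andP[/eqP ha' h'] hp /andP[hn hu].
have e : a = a'.
  apply/eqP; apply: contraT => hne.
  have : a' \in a :: d by rewrite (perm_mem hp) mem_head.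
  rewrite inE eq_sym (negbTE hne) /= => hin.
  by move: hn; rewrite ha -ha' map_f.
subst a'; congr (_ :: _); apply: IH h h' _ hu; by rewrite perm_cons in hp.
Qed.

Lemma splitT (v : V) c : v \in map tl c -> exists d e, [/\ c = d ++ e, e != [::] & forall x y, wpath x c y -> wpath x d v /\ wpath v e y].
Proof.
case/mapP=> a /splitS[d [e ->]] ->; exists d, (a :: e); split=> // x y h.
by have [h1 h2] := wpath_mid h; rewrite h1 /= eqxx.
Qed.

Lemma prim_rot v c x : prim v c -> x \in map tl c ->
  exists d e, [/\ c = d ++ e, wpath v d x, wpath x e v & prim x (e ++ d)].
Proof.
case/and3P=> hn hc hu /splitT[d [e [E he /(_ _ _ hc)[h1 h2]]]].
exists d, e; split=> //; apply/and3P; split.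
- by case: e he {E h2}.
- exact: wpath_cat h2 h1.
- move: hu; rewrite E !map_cat; by rewrite uniq_catC.
Qed.

Lemma prim_perm v x c c' : prim v c -> prim x c' -> perm_eq c c' ->
  exists d e, [/\ c = d ++ e, c' = e ++ d, wpath v d x & wpath x e v].
Proof.
move=> hc hc' hp.
have hx : x \in map tl c.
  rewrite (perm_mem (perm_map tl hp)); case/and3P: hc'.
  by case: c' {hp} => //= a c' _ /andP[/eqP<- _] _; rewrite mem_head.
have [d [e [E h1 h2 h3]]] := prim_rot hc hx.
exists d, e; split=> //.
case/and3P: hc' => _ h4 h5; case/and3P: h3 => _ h6 h7.
apply: path_uniq h4 h6 _ h5; rewrite perm_sym in hp; apply: perm_trans hp _.
by rewrite E perm_catC.
Qed.

(** Induction on [d]. Its first arrow [a] occurs in [w]; the cycle moves to just before that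
    occurrence. There the cycle [a d e] followed by [a] reads as [a] followed by the rotated cycle
    [d e a], inserted one vertex further along [d]. *)
Lemma slide x y w d e v1 v2 u1 u2 u1' u2' : wpath x w y ->
  wpath v1 d v2 -> wpath v2 e v1 -> {subset d <= w} ->
  w = u1 ++ u2 -> w = u1' ++ u2' -> wpath x u1 v1 -> wpath x u1' v2 ->
  eqv (u1 ++ (d ++ e) ++ u2) (u1' ++ (e ++ d) ++ u2').
Proof.
move=> hw; elim: d e v1 u1 u2 => [|a d IH] e v1 u1 u2.
  move=> /= /eqP-> he _ -> e2 h1 h2; rewrite cats0; exact: ins_same he e2 h1 h2.
rewrite wpath_cons => /andP[/eqP ha hd1] he hs e1 e2 h1 h2.
have /splitS[w1 [w2 e3]] : a \in w by apply: hs; rewrite mem_head.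
have h3 : wpath x w1 (tl a) by move: hw; rewrite e3 => /wpath_mid[].
have hcl : wpath v1 ((a :: d) ++ e) v1.
  by apply: wpath_cat _ he; rewrite wpath_cons ha eqxx hd1.
apply: (@eqv_trans _ _ _ _ _ (w1 ++ ((a :: d) ++ e) ++ a :: w2)).
  by apply: (ins_same (x := x) hcl); rewrite -?e1 -?e3 // -ha.
have := IH (e ++ [:: a]) (hd a) (w1 ++ [:: a]) w2 hd1.
rewrite /= -?catA /= -?catA => H; rewrite /= -?catA /=; apply: H => //.
- by apply: wpath_cat he _; rewrite /= ha !eqxx.
- by move=> b hb; apply: hs; rewrite inE hb orbT.
- by apply: wpath_cat h3 _; rewrite /= !eqxx.
Qed.

Lemma count_split a w : 0 < count_mem a w -> exists u1 u2, w = u1 ++ a :: u2.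
Proof. by rewrite -has_count has_pred1 => /splitS. Qed.

(** A prefix [R] of [c] is grown inside the word, one arrow [g] at a time. Tails on [c] are
    distinct, so at least two copies of [g] lie outside [R]; they yield two closed factors at [tl g]
    whose exchange puts [g] right after [R]. *)
Lemma gather x y w v c : wpath x w y -> prim v c -> (forall g, g \in c -> 1 < count_mem g w) ->
  exists al be, eqv w (al ++ c ++ be).
Proof.
move=> hw /and3P[hn hc hu] hdup.
suff H : forall R S, c = R ++ S -> R != [::] -> exists al be, eqv w (al ++ R ++ be).
  by apply: (H c [::]); rewrite ?cats0.
elim/last_ind=> [//|R g IH] S E _.
have [->|hR] := eqVneq R [::].
  have /splitS[u1 [u2 ->]] : g \in w.
    rewrite -has_pred1 has_count; apply: leq_trans (hdup g _) => //.
    by rewrite E mem_cat mem_rcons mem_head.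
  by exists u1, u2; apply: eqv_refl.
rewrite cat_rcons in E.
have [al [be h]] := IH _ E hR.
have hw1 := eqv_wpath h hw.
have [hR1 _] : wpath v R (tl g) /\ wpath (hd g) S v by apply: wpath_mid; rewrite -E.
have [t h1 h2] : exists2 t, wpath x al t & wpath t (R ++ be) y by apply/wpathP.
have ht : t = v by case: (R) hR hR1 h2 => // r R' _ /= /andP[/eqP<- _] /andP[/eqP<- _].
rewrite {}ht in h1 h2.
have h3 := wpath_catr hR1 h2.
have hcnt : 1 < count_mem g al + count_mem g be.
  have gR : g \notin R.
    move: hu; rewrite E map_cat cat_uniq /= => /and3P[_ + _].
    by rewrite negb_or => /andP[hg _]; apply: contra hg => hg; rewrite map_f.
  have := hdup g; rewrite E mem_cat mem_head orbT => /(_ isT).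
  by rewrite (permP (eqv_perm h)) !count_cat (count_memPn gR) add0n.
(* Two copies before [R]: exchange [g A3] with [g A4 R]. *)
case: (posnP (count_mem g be)) => hbe.
  rewrite hbe addn0 in hcnt.
  have [A1 [A2 eA]] := count_split (ltnW hcnt).
  wlog hA2 : A1 A2 eA / 0 < count_mem g A2.
    move=> H; case: (posnP (count_mem g A2)) => h0; last exact: (H A1 A2 eA h0).
    have [B1 [B2 eB]] : exists B1 B2, A1 = B1 ++ g :: B2.
      by apply: count_split; move: hcnt; rewrite eA count_cat /= eqxx h0; clia.
    apply: (H B1 (B2 ++ g :: A2)); first by rewrite eA eB -catA.
    by rewrite count_cat /= eqxx addnCA.
  have [A3 [A4 eA2]] := count_split hA2.
  exists (A1 ++ g :: A4), (A3 ++ be).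
  rewrite eA eA2 in h h1.
  have [h4 h5] := wpath_mid h1; have [h6 h7] := wpath_mid h5.
  apply: eqv_trans h _.
  apply: (swapE (v := tl g) (al := A1) (p := g :: A3) (q := g :: A4 ++ R) (be := be)).
  - by rewrite /= eqxx.
  - by rewrite /= eqxx /=; apply: wpath_cat h7 hR1.
  - by lsolve.
  - by rewrite -cats1; lsolve.
have [B1 [B2 eB]] := count_split hbe.
rewrite eB in h h3 hcnt; have [h4 h5] := wpath_mid h3.
(* Two copies after [R]: exchange the factor up to the first with the factor between the two. *)
case: (posnP (count_mem g B2)) => hB2; last first.
  have [B3 [B4 eB2]] := count_split hB2; rewrite eB2 in h h5.
  have [h6 _] := wpath_mid h5.
  exists al, (B3 ++ B1 ++ g :: B4); apply: eqv_trans h _.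
  apply: (swapE (v := tl g) (al := al ++ R) (p := B1) (q := g :: B3) (be := g :: B4)).
  - exact: h4.
  - by rewrite /= eqxx.
  - by lsolve.
  - by rewrite -cats1; lsolve.
case: (posnP (count_mem g B1)) => hB1; last first.
  have [B3 [B4 eB1]] := count_split hB1; rewrite eB1 in h h4.
  have [h6 h7] := wpath_mid h4.
  exists al, (B4 ++ B3 ++ g :: B2); apply: eqv_trans h _.
  apply: (swapE (v := tl g) (al := al ++ R) (p := B3) (q := g :: B4) (be := g :: B2)).
  - exact: h6.
  - by rewrite /= eqxx.
  - by lsolve.
  - by rewrite -cats1; lsolve.
(* One copy on each side: exchange [g A2 R] with [B1]. *)
have [A1 [A2 eA]] : exists A1 A2, al = A1 ++ g :: A2.
  by apply: count_split; move: hcnt; rewrite count_cat /= eqxx hB1 hB2; clia.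
rewrite eA in h h1; have [h6 h7] := wpath_mid h1.
exists (A1 ++ B1 ++ g :: A2), B2; apply: eqv_trans h _.
apply: (swapE (v := tl g) (al := A1) (p := g :: A2 ++ R) (q := B1) (be := g :: B2)).
- by rewrite /= eqxx /=; apply: wpath_cat h7 hR1.
- exact: h4.
- by lsolve.
- by rewrite -cats1; lsolve.
Qed.

Section Fixed.
Variables (x y v0 : V) (c : seq A).
Hypothesis hc : prim v0 c.

(* [u] is, up to equivalence, [w] with a rotation of [c] inserted; by [attach_uniq] the place does
   not matter once all arrows of [c] occur in [w]. *)
Definition attach w u := exists (g1 g2 : seq A) v c', [/\ w = g1 ++ g2, wpath x g1 v, prim v c',
  perm_eq c' c & eqv u (g1 ++ c' ++ g2)].

Lemma attach_eqv w u u' : attach w u -> eqv u u' -> attach w u'.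
Proof.
move=> [g1 [g2 [v [c' [e h1 h2 h3 h4]]]]] h; exists g1, g2, v, c'; split=> //.
by apply: eqv_trans h4; apply: eqv_sym.
Qed.

Lemma attach_uniq w u u' : wpath x w y -> {subset c <= w} -> attach w u -> attach w u' -> eqv u u'.
Proof.
move=> hw hs [g1 [g2 [v [c1 [e h1 h2 h3 h4]]]]] [g1' [g2' [v' [c2 [e' h1' h2' h3' h4']]]]].
have hp : perm_eq c1 c2 by apply: perm_trans h3 _; rewrite perm_sym.
have [d [f [ec1 ec2 h5 h6]]] := prim_perm h2 h2' hp.
apply: eqv_trans h4 _; apply: eqv_trans (eqv_sym h4').
rewrite ec1 ec2; apply: (slide hw h5 h6 _ e e' h1 h1').
by move=> a ha; apply: hs; rewrite -(perm_mem h3) ec1 mem_cat ha.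
Qed.

Lemma prim_at v : v \in map tl c -> exists c', prim v c' /\ perm_eq c' c.
Proof.
move=> /(prim_rot hc)[d [e [-> _ _ h]]]; exists (e ++ d); split=> //; by rewrite perm_catC.
Qed.

Lemma interlace P S M S' N v t : v \in map tl c -> t \in map tl c ->
  wpath x P v -> wpath v S t -> wpath t M v -> wpath v S' t ->
  exists2 u, attach (P ++ S ++ M ++ S' ++ N) u & attach (P ++ S' ++ M ++ S ++ N) u.
Proof.
move=> hv ht hP hS hM hS'.
have [ct [h1 h2]] := prim_at ht.
have hv' : v \in map tl ct by rewrite (perm_mem (perm_map tl h2)).
have [d [e [E hd1 he hp]]] := prim_rot h1 hv'.
exists (P ++ S ++ ct ++ M ++ S' ++ N).
  exists (P ++ S), (M ++ S' ++ N), t, ct; split=> //; first by lsolve.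
    exact: wpath_cat hP hS.
  by apply: eqvE; lsolve.
exists P, (S' ++ M ++ S ++ N), v, (e ++ d); split=> //.
  by apply: perm_trans h2; rewrite E perm_catC.
apply: (@eqv_trans _ _ _ _ _ (P ++ (e ++ M) ++ (S ++ d) ++ S' ++ N)).
  apply: (swapE (v := v) (al := P) (p := S ++ d) (q := e ++ M) (be := S' ++ N)) => //.
  - exact: wpath_cat hS hd1.
  - exact: wpath_cat he hM.
  - by rewrite E; lsolve.
apply: (swapE (v := t) (al := P ++ e) (p := M ++ S) (q := d ++ S') (be := N)).
- exact: wpath_cat hM hS.
- exact: wpath_cat hd1 hS'.
- by lsolve.
- by lsolve.
Qed.

Lemma exit_arrow (X : pred V) (a b : V) (N : seq A) : wpath a N b -> X a -> ~~ X b ->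
  exists g, [/\ g \in N, X (tl g) & ~~ X (hd g)].
Proof.
elim: N a => [|g N IH] a /=; first by move=> /eqP-> ->.
case/andP=> /eqP<- h ha hb; case E : (X (hd g)).
  by have [g' [h1 h2 h3]] := IH _ h E hb; exists g'; rewrite inE h1 orbT.
by exists g; rewrite mem_head ha E.
Qed.

(* As in Kotzig's theorem on Eulerian trails, an exchange makes the first arrows [s], [s'] after the
   common prefix [P] agree. An exchange of interlaced factors is not an equivalence by itself, but
   the attached [c] provides the missing return path. *)
Lemma kotzig n P t t' : size t <= n -> wpath x (P ++ t) y -> wpath x (P ++ t') y ->
  perm_eq t t' -> {subset c <= P ++ t} -> x \in map tl c ->
  (forall a, a \in P ++ t -> (tl a \in map tl c) && (hd a \in map tl c)) ->
  exists2 u, attach (P ++ t) u & attach (P ++ t') u.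
Proof.
elim: n P t t' => [|n IH] P t t'.
all: case: t => [|s t1] hsz hw hw' hp hs hx hV.
1,3: have -> : t' = [::] by apply/nilP; rewrite /nilp -(perm_size hp).
1,2: have [c' [h1 h2]] := prim_at hx; rewrite cats0 in hw *; exists (c' ++ P);
  exists [::], P, x, c'; split=> //=; rewrite ?eqxx //; exact: eqv_refl.
- by [].
case: t' => [|s' t1'] in hw' hp *; first by have := perm_size hp.
have [hss|hss] := eqVneq s s'.
  rewrite -{}hss in hp hw' *.
  have := IH (rcons P s) t1 t1'; rewrite !cat_rcons; apply=> //.
  by rewrite perm_cons in hp.
(* Once [s'] comes first in some rearrangement [t2], induction compares [t2] with [t'], and
   [attach_uniq] joins the two common attachments. *)
suff [t2 [h1 h2 [u0 h3 h4]]] : exists t2, [/\ wpath x (P ++ s' :: t2) y, perm_eq (s' :: t2) (s :: t1)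
    & exists2 u, attach (P ++ s :: t1) u & attach (P ++ s' :: t2) u].
  have hs2 : P ++ s :: t1 =i P ++ s' :: t2.
    by apply: perm_mem; rewrite perm_cat2l perm_sym.
  have h5 : perm_eq (s' :: t2) (s' :: t1') by apply: perm_trans h2 hp.
  have hsz2 : size t2 <= n by have := perm_size h2 => /= -[->].
  have := IH (rcons P s') t2 t1' hsz2; rewrite !cat_rcons => /(_ h1 hw').
  rewrite perm_cons in h5 => /(_ h5) [|//||u1 h6 h7].
  - by move=> a /hs; rewrite hs2.
  - by move=> a; rewrite -hs2; apply: hV.
  exists u0 => //; apply: attach_eqv h7 _.
  by apply: (attach_uniq h1 _ h6 h4) => a /hs; rewrite hs2.
have [hP h1] := wpath_mid hw; have [hP' h1'] := wpath_mid hw'.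
have etl := wpath_end hP hP'.
have : s' \in s :: t1 by rewrite (perm_mem hp) mem_head.
rewrite inE eq_sym (negbTE hss) /= => /splitS[M [N eM]].
rewrite eM in h1 hw hs hV hp *; have [h2 h3] := wpath_mid h1.
have hxc : tl s \in map tl c.
  by have := hV s; rewrite mem_cat mem_head orbT => /(_ isT)/andP[].
(* If the word returns to [tl s] after [s'], then [s M] and [s' N1] are adjacent and closed at
   [tl s]: one swap. *)
case hN : (tl s \in verts hd (hd s') N).
  have [N1 [N2 [eN h4 h5]]] := vertsE h3 hN.
  have [c' [hc1 hc2]] := prim_at hxc.
  have hc3 : wpath (tl s) c' (tl s) by case/and3P: hc1.
  exists (N1 ++ s :: M ++ N2); split.
  - apply: wpath_cat hP' _; rewrite /= eqxx /=; apply: wpath_cat h4 _.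
    by rewrite /= eqxx /=; apply: wpath_cat h2 _; rewrite -etl.
  - rewrite eN; rewrite -[s' :: _]/((s' :: N1) ++ (s :: M) ++ N2).
    by rewrite -[s :: _ ++ _]/((s :: M) ++ (s' :: N1) ++ N2) perm_catCA.
  exists (P ++ c' ++ s :: M ++ s' :: N).
    by exists P, (s :: M ++ s' :: N), (tl s), c'; split=> //; apply: eqv_refl.
  exists P, (s' :: N1 ++ s :: M ++ N2), (tl s), c'; split=> //.
  apply: (swapE (v := tl s) (al := P ++ c') (p := s :: M) (q := s' :: N1) (be := N2)).
  - by rewrite /= eqxx /= etl.
  - by rewrite /= etl eqxx /= -etl.
  - by rewrite eN; lsolve.
  - by lsolve.
(* Otherwise [t'] leads from [s'] back to [tl s], which [N] misses, so it leaves the vertices of [N]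
   by an arrow [g]. This [g] must lie in [M], and [tl g] is also visited by [N]: the factors from
   [tl s] to [tl g] interlace. *)
have [N' [N'' eN']] : exists N' N'', t1' = N' ++ s :: N''.
  apply: splitS; have : s \in s' :: t1' by rewrite -(perm_mem hp) mem_head.
  by rewrite inE (negbTE hss).
have [_ h4] := wpath_mid hw'; rewrite eN' in h4; have [h5 _] := wpath_mid h4.
have hin : hd s' \in verts hd (hd s') N by rewrite mem_head.
have [g [hg1 hg2 hg3]] := exit_arrow (X := mem (verts hd (hd s') N)) h5 hin (negbT hN).
have gM : g \in M.
  have : g \in s :: M ++ s' :: N by rewrite (perm_mem hp) eN' inE mem_cat hg1 orbT.
  rewrite inE mem_cat inE => /or4P[/eqP e|//|/eqP e|gN].
  - by move: hg2; rewrite e /= hN.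
  - by move: hg2; rewrite e /= -etl hN.
  - by case/negP: hg3; rewrite /= hd_verts.
have [M1 [M2 eM1]] := splitS gM.
have [N1 [N2 [eN h6 h7]]] := vertsE h3 hg2.
rewrite eM1 in h2; have [h8 h9] := wpath_mid h2.
exists (N1 ++ (g :: M2) ++ (s :: M1) ++ N2); split.
- apply: wpath_cat hP' _; rewrite /= eqxx /=; apply: wpath_cat h6 _.
  rewrite /= eqxx /=; apply: wpath_cat h9 _; rewrite /= etl eqxx /=.
  exact: wpath_cat h8 h7.
- by apply/permP => X; rewrite eN eM1; cnt; clia.
rewrite eN eM1.
have -> : P ++ s :: (M1 ++ g :: M2) ++ s' :: N1 ++ N2
          = P ++ (s :: M1) ++ (g :: M2) ++ (s' :: N1) ++ N2 by lsolve.
apply: (@interlace P (s :: M1) (g :: M2) (s' :: N1) N2 (tl s) (tl g)) => //.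
- have /andP[] // : (tl g \in map tl c) && (hd g \in map tl c).
  by apply: hV; rewrite mem_cat inE mem_cat gM !orbT.
- by rewrite /= eqxx.
- by rewrite /= eqxx etl.
- by rewrite /= etl eqxx.
Qed.

(** After [gather], [c] is a factor of both words, and what is left without it still contains every
    arrow of [c]. So [kotzig] gives a common attachment, and [attach_uniq] identifies it with both
    words. *)
Theorem rearrange w w' : wpath x w y -> wpath x w' y -> perm_eq w w' ->
  (forall a, a \in w -> (tl a \in map tl c) && (hd a \in map tl c)) ->
  (forall g, g \in c -> 1 < count_mem g w) -> eqv w w'.
Proof.
move=> hw hw' hp hV hdup.
have [al [be h]] := gather hw hc hdup.
have [al' [be' h']] : exists al be, eqv w' (al ++ c ++ be).
  by apply: gather hw' hc _ => g /hdup; rewrite (permP hp).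
have key (z a b : seq A) : wpath x z y -> eqv z (a ++ c ++ b) -> wpath x a v0 /\ wpath v0 b y.
  move=> hz e; have /wpathP[t h2 h3] := eqv_wpath e hz; case/and3P: hc => hn h1 _.
  have e1 : v0 = t by case: (c) hn h1 h3 => // k c0 _ /= /andP[/eqP<- _] /andP[/eqP<- _].
  by rewrite -e1 in h2 h3; split=> //; apply: wpath_catr h1 h3.
have [h1 h2] := key _ _ _ hw h; have [h1' h2'] := key _ _ _ hw' h'.
have p1 := eqv_perm h; have p2 := eqv_perm h'.
have p3 : perm_eq (al ++ be) (al' ++ be').
  have : perm_eq (al ++ c ++ be) (al' ++ c ++ be').
    by apply: perm_trans p2; apply: perm_trans hp; rewrite perm_sym.
  by rewrite [perm_eq (al ++ _) _]perm_catCA perm_sym [perm_eq (al' ++ _) _]perm_catCA perm_cat2l perm_sym.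
have hw1 : wpath x (al ++ be) y by apply: wpath_cat h1 h2.
have hw1' : wpath x (al' ++ be') y by apply: wpath_cat h1' h2'.
have hsub : {subset c <= al ++ be}.
  move=> g gc; have := hdup g gc; rewrite (permP p1) !count_cat.
  have : count_mem g c <= 1.
    have uc : uniq c by case/and3P: hc => _ _ /map_uniq.
    by rewrite count_uniq_mem //; case: (g \in c).
  by rewrite -has_pred1 has_count count_cat; clia.
have hx : x \in map tl c.
  have : 0 < size w.
    case: (w) hdup => // hdup0; case/and3P: hc; case: (c) hdup0 => // k c0 /(_ k).
    by rewrite mem_head => /(_ isT).
  case: w hw hV {hp hdup h p1} => //= a w /andP[/eqP<- _] /(_ a).
  by rewrite mem_head => /(_ isT)/andP[].
have hV1 a : a \in al ++ be -> (tl a \in map tl c) && (hd a \in map tl c).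
  by move=> ha; apply: hV; rewrite (perm_mem p1) !mem_cat in ha *; case/orP: ha => ->; rewrite ?orbT.
have [u k1 k2] := @kotzig _ [::] _ _ (leqnn _) hw1 hw1' p3 hsub hx hV1.
have a1 : attach (al ++ be) w by exists al, be, v0, c.
have a2 : attach (al' ++ be') w' by exists al', be', v0, c.
apply: eqv_trans (attach_uniq hw1 hsub a1 k1) _.
by apply: attach_uniq hw1' _ k2 a2 => g /hsub; rewrite (perm_mem p3).
Qed.
End Fixed.
End Kotzig.

(** * Balanced families of arrows and Eulerian trails *)

Section Euler.
Variables (V A : eqType) (tl hd : A -> V).
Implicit Types (x y v : V) (a b g : A) (u w p q c z : seq A).
Notation wpath := (wpath tl hd).
Notation prim := (prim tl hd).

(** Euler's degree condition for a trail from [x] to [y] using each entry of [l] once. *)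
Definition bal x (l : seq A) y := forall v,
  count (fun a => tl a == v) l + (v == y) = count (fun a => hd a == v) l + (v == x).

Lemma bal_path x l y : wpath x l y -> bal x l y.
Proof.
elim: l x => [|a l IH] x /=; first by move=> /eqP-> v.
case/andP=> /eqP ha /IH h v /=; have := h v; rewrite ha [x == v]eq_sym [hd a == v]eq_sym; clia.
Qed.

Lemma bal_any x y l : bal x l x -> bal y l y.
Proof. by move=> h v; have := h v; clia. Qed.

Lemma bal_perm x y l l' : perm_eq l l' -> bal x l y -> bal x l' y.
Proof. by move=> /permP hp h v; rewrite -!hp. Qed.

Lemma bal_cat x l l' y : bal x l x -> bal x (l ++ l') y -> bal x l' y.
Proof. by move=> h1 h2 v; have := h1 v; have := h2 v; rewrite !count_cat; clia. Qed.

Lemma bal_cat2 x l l' : bal x l x -> bal x l' x -> bal x (l ++ l') x.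
Proof. by move=> h1 h2 v; have := h1 v; have := h2 v; rewrite !count_cat; clia. Qed.

Lemma perm_split (T : eqType) (s : T) (l : seq T) : s \in l -> exists l1, perm_eq l (s :: l1).
Proof. by move=> h; exists (rem s l); apply: perm_to_rem. Qed.

(** Greedy walk: as long as [x] differs from [y], balance provides an arrow leaving [x]. *)
Lemma trail l x y : bal x l y ->
  exists p l', [/\ perm_eq l (p ++ l'), wpath x p y & bal x l' x].
Proof.
have [n] := ubnP (size l); elim: n l x => // n IH l x hsz hb.
have [e|hxy] := eqVneq x y.
  by rewrite -e in hb; exists [::], l; split; rewrite //= ?e //.
have : has (fun a => tl a == x) l.
  by rewrite has_count; have := hb x; rewrite eqxx (negbTE hxy); clia.
case/hasP=> s hs /eqP es; have [l1 hp] := perm_split hs.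
have hb1 : bal (hd s) l1 y.
  move=> v; have := bal_perm hp hb v; rewrite /= es [x == v]eq_sym [hd s == v]eq_sym; clia.
have hsz1 : size l1 < n by have := perm_size hp => /= e; move: hsz; rewrite e.
have [p [l' [h1 h2 h3]]] := IH _ _ hsz1 hb1.
exists (s :: p), l'; split.
- by apply: perm_trans hp _; rewrite /= perm_cons.
- by rewrite /= es eqxx.
- exact: bal_any h3.
Qed.

Lemma trail_through l x s : bal x l x -> s \in l ->
  exists p l', [/\ perm_eq l ((s :: p) ++ l'), wpath (tl s) (s :: p) (tl s) & bal x l' x].
Proof.
move=> hb hs; have [l1 hp] := perm_split hs.
have hb1 : bal (hd s) l1 (tl s).
  by move=> v; have := bal_perm hp hb v; rewrite /= [tl s == v]eq_sym [hd s == v]eq_sym; clia.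
have [p [l' [h1 h2 h3]]] := trail hb1.
exists p, l'; split.
- by apply: perm_trans hp _; rewrite /= perm_cons.
- by rewrite /= eqxx.
- exact: bal_any h3.
Qed.

(** Closed trails are split off and spliced into a circuit one by one. The circuit contains the
    arrows of [c], hence passes through every vertex concerned, which takes care of connectivity. *)
Lemma euler c v0 l x v : prim v0 c -> bal x l x -> v \in map tl c ->
  (forall a, a \in l -> (tl a \in map tl c) && (hd a \in map tl c)) ->
  exists2 W, perm_eq W (c ++ l) & wpath v W v.
Proof.
move=> hc; have [n] := ubnP (size l); elim: n l => // n IH l hsz hb hv hV.
case: l => [|s l1] in hsz hb hV *.
  have [c' [/and3P[_ h1 _] h2]] := prim_at hc hv; exists c' => //; by rewrite cats0.
have [p [l' [h1 h2 h3]]] := trail_through hb (mem_head s l1).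
have hsz' : size l' < n by have := perm_size h1; rewrite /= size_cat => e; move: hsz => /=; rewrite e; clia.
have hV' a : a \in l' -> (tl a \in map tl c) && (hd a \in map tl c).
  by move=> ha; apply: hV; rewrite (perm_mem h1) mem_cat ha orbT.
have [W h4 h5] := IH _ hsz' h3 hv hV'.
have : tl s \in map tl W.
  rewrite (perm_mem (perm_map tl h4)) map_cat mem_cat.
  by have /andP[->] := hV s (mem_head _ _).
move=> hin; have [d [e [E _ /(_ _ _ h5)[h6 h7]]]] := @splitT _ _ tl hd _ _ hin.
exists (d ++ (s :: p) ++ e); last by apply: wpath_cat h6 _; apply: wpath_cat h2 h7.
apply/permP => X; move/permP/(_ X): h1; move/permP/(_ X): h4.
by rewrite E; cnt; clia.
Qed.

Lemma sub_perm (T : eqType) (s l : seq T) : (forall k : T, count_mem k s <= count_mem k l) ->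
  exists D : seq T, perm_eq l (s ++ D).
Proof.
elim: s l => [|k s IH] l h; first by exists l.
have hk : k \in l by rewrite -has_pred1 has_count; have := h k; rewrite /= eqxx; clia.
have [l1 hp] := perm_split hk.
have [D hD] : exists D : seq T, perm_eq l1 (s ++ D).
  by apply: IH => k'; have := h k'; rewrite (permP hp) /=; clia.
by exists D; apply: perm_trans hp _; rewrite /= perm_cons.
Qed.
End Euler.

(** * Cutting words at the visits to a vertex set *)

Section Cut.
Variables (V A : eqType) (tl hd : A -> V) (v0 : V).
Implicit Types (x y v : V) (a b g : A) (u w p q c z : seq A) (l : seq (seq A)).
Notation wpath := (wpath tl hd).
Notation eqv := (eqv tl hd).
Notation prim := (prim tl hd).

(* A path is cut at its visits to [C]; the pieces are the arrows, from [stl] to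
   [shd], of a quiver on [C] to which [rearrange] applies. *)
Definition stl (s : seq A) := if s is a :: _ then tl a else v0.
Definition shd (s : seq A) := if s is a :: s' then last (hd a) (map hd s') else v0.
Notation swpath := (Word.wpath stl shd).

Variable C : pred V.

(** A first-return piece; [take (size s).-1] leaves out the last arrow, whose head is the end of the
    piece. *)
Definition segm (s : seq A) := [&& s != [::], wpath (stl s) s (shd s), C (stl s), C (shd s)
  & all (fun a => ~~ C (hd a)) (take (size s).-1 s)].

Lemma wpath_shd x s y : s != [::] -> wpath x s y -> x = stl s /\ y = shd s.
Proof.
case: s => // a s _ /= /andP[/eqP<-]; elim: s a => [|b s IH] a /=; first by move=> /eqP.
by case/andP=> _ /IH[_ ->].
Qed.

Lemma segmE s0 a x y : wpath x (rcons s0 a) y -> C x -> C (hd a) -> all (fun a => ~~ C (hd a)) s0 ->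
  segm (rcons s0 a) /\ (stl (rcons s0 a) = x /\ shd (rcons s0 a) = y).
Proof.
move=> h hx ha hs; have hn : rcons s0 a != [::] by case: (s0).
have [e1 e2] := wpath_shd hn h; split=> //; apply/and5P; split=> //.
- by rewrite -e1 -e2.
- by rewrite -e1.
- by rewrite -cats1 in h; have [_ /= /eqP e] := wpath_mid h; rewrite -e2 -e.
- by rewrite size_rcons /= -cats1 take_size_cat.
Qed.

Lemma first_hit w : has (fun a => C (hd a)) w ->
  exists s0 a w', [/\ w = rcons s0 a ++ w', C (hd a) & all (fun a => ~~ C (hd a)) s0].
Proof.
elim: w => // b w IH /=; case E : (C (hd b)) => /=.
  by move=> _; exists [::], b, w.
case/IH=> s0 [a [w' [-> h1 h2]]]; exists (b :: s0), a, w'; by rewrite /= E h2.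
Qed.

Lemma cut x w y : wpath x w y -> C x -> C y ->
  exists l, [/\ w = flatten l, all segm l & swpath x l y].
Proof.
have [n] := ubnP (size w); elim: n w x => // n IH w x hsz h hx hy.
case: w => [|a w] in hsz h *; first by exists [::].
have hh : has (fun a => C (hd a)) (a :: w).
  elim: w a x {hsz hx} h => [|b w IHw] a x /=; first by case/andP=> _ /eqP->; rewrite hy.
  case/andP=> _ h; apply/orP; right; exact: (IHw b (hd a) h).
have [s0 [b [w' [E hb hs0]]]] := first_hit hh; rewrite E in h hsz *.
have [v h1 h2] := elimT (wpathP _ _ _ _ _ _) h.
have [h3 [e1 e2]] := segmE h1 hx hb hs0.
have hv : C v by rewrite -e2; case/and5P: h3.
have hsz' : size w' < n by move: hsz; rewrite size_cat size_rcons; clia.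
have [l [-> h4 h5]] := IH _ _ hsz' h2 hv hy.
exists (rcons s0 b :: l); split=> //=; first by rewrite h3.
by rewrite e1 eqxx e2.
Qed.

Lemma segm_path s : segm s -> wpath (stl s) s (shd s).
Proof. by case/and5P. Qed.

Lemma flat_path x l y : all segm l -> swpath x l y -> wpath x (flatten l) y.
Proof.
elim: l x => [|s l IH] x //= /andP[hs hl] /andP[/eqP<- h].
by apply: wpath_cat (segm_path hs) _; apply: IH.
Qed.

Lemma flat_eqv l l' : all segm l -> Word.eqv stl shd l l' -> eqv (flatten l) (flatten l').
Proof.
move=> hl; elim=> [|v al p q be h1 h2 hp hq]; first exact: eqv_refl.
apply: eqv_trans h2 _; rewrite !flatten_cat.
have : all segm (al ++ p ++ q ++ be) by rewrite -(perm_all _ (eqv_perm h1)).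
rewrite !all_cat => /and4P[_ gp gq _].
by apply: (swapE (flat_path gp hp) (flat_path gq hq)).
Qed.

(** In a piece of two or more arrows every arrow has an inner vertex, outside [C], as an end. So an
    arrow with both ends in [C] is always a piece of its own. *)
Lemma count_single l a : all segm l -> C (tl a) -> C (hd a) ->
  count_mem a (flatten l) = count_mem [:: a] l.
Proof.
move=> + ht hh; elim: l => // s l IH /= /andP[hs hl]; rewrite count_cat IH //; congr (_ + _).
case/and5P: hs => hn hp _ hc hall.
case/lastP: s => // s b in hn hp hc hall *.
rewrite size_rcons /= -cats1 take_size_cat // in hall.
case: s => [|b' s] in hn hp hc hall *.
  by rewrite /= addn0; congr nat_of_bool; apply/eqP/eqP => [->|[]].
have -> : (rcons (b' :: s) b == [:: a]) = false by apply/negbTE/negP => /eqP/(congr1 size) /=; rewrite size_rcons.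
apply/count_memPn; apply/negP => ha; have [s1 [s2 E]] := splitS ha.
rewrite E in hp; have [h1 _] := wpath_mid hp.
case/lastP: s1 => [|s1 k] in E hp h1.
  move: E; rewrite rcons_cons => -[eb E2]; subst b'.
  by move: hall => /= /andP[]; rewrite hh.
have hk : k \in b' :: s.
  have [s3 [k2 e3]] : exists s3 k2, a :: s2 = rcons s3 k2.
    by exists (belast a s2), (last a s2); rewrite lastI.
  move: E; rewrite e3 -rcons_cat => /rcons_inj[-> _].
  by rewrite mem_cat mem_rcons mem_head.
have := allP hall k hk; rewrite -cats1 in h1.
by have [_ /= /eqP ->] := wpath_mid h1; rewrite ht.
Qed.

(** The part [p0] precedes the first visit to [C]; it contains no arrow of a cycle on [C], so
    setting it aside keeps the multiplicities of such arrows. *)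
Lemma decomp_left x p v : wpath x p v -> C v -> exists p0 p1 x',
  [/\ p = p0 ++ p1, wpath x p0 x', wpath x' p1 v, C x' & forall g, g \in p0 -> ~~ C (tl g)].
Proof.
elim: p x => [|a p IH] x /=.
  by move=> /eqP-> hv; exists [::], [::], v; rewrite /= eqxx.
case/andP=> ha h hv; case E : (C x).
  by exists [::], (a :: p), x; rewrite /= eqxx ha h.
have [p0 [p1 [x' [-> h1 h2 h3 h4]]]] := IH _ h hv.
exists (a :: p0), p1, x'; split=> //=; first by rewrite ha.
by move=> g; rewrite inE => /orP[/eqP->|/h4//]; rewrite (eqP ha) E.
Qed.

Lemma decomp_right v p y : wpath v p y -> C v -> exists p1 p0 y',
  [/\ p = p1 ++ p0, wpath v p1 y', wpath y' p0 y, C y' & forall g, g \in p0 -> ~~ C (hd g)].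
Proof.
elim/last_ind: p y => [|p a IH] y.
  by move=> /= /eqP-> hv; exists [::], [::], y; rewrite /= eqxx.
move=> h hv; case E : (C y).
  by exists (rcons p a), [::], y; rewrite /= eqxx cats0.
rewrite -cats1 in h *; have [h1 /= h2] := wpath_mid h.
have [p1 [p0 [y' [-> h3 h4 h5 h6]]]] := IH _ h1 hv.
exists p1, (rcons p0 a), y'; split=> //; first by rewrite -cats1 catA.
  by rewrite -cats1; apply: wpath_cat h4 _; rewrite /= eqxx.
by move=> g; rewrite mem_rcons inE => /orP[/eqP->|/h6//]; rewrite (eqP h2) E.
Qed.
End Cut.

(** * Rearranging the pieces cut out by a primitive cycle *)

Section Cyc.
Variables (V A : eqType) (tl hd : A -> V).
Implicit Types (x y v : V) (a b g : A) (u w p q c z : seq A) (l : seq (seq A)).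
Notation wpath := (wpath tl hd).
Notation eqv := (eqv tl hd).
Notation prim := (prim tl hd).
Variables (v0 : V) (c : seq A).
Hypothesis hc : prim v0 c.
Let C : pred V := mem (map tl c).
Notation segm := (segm tl hd v0 C).
Notation swpath := (Word.wpath (stl tl v0) (shd hd v0)).
(** The cycle [c] seen in the quiver of pieces. *)
Definition cB := map (fun a => [:: a]) c.

Lemma closed_hd v w : wpath v w v -> map hd w =i map tl w.
Proof.
move=> h x; have e : count (fun a => hd a == x) w = count (fun a => tl a == x) w.
  by have := bal_path h x; clia.
rewrite -!has_pred1 !has_map !has_count; exact: (congr1 (ltn 0) e).
Qed.

Lemma c_ends g : g \in c -> C (tl g) /\ C (hd g).
Proof.
move=> h; split; first exact: map_f.
by case/and3P: hc => _ /closed_hd e _; rewrite /C /= -e map_f.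
Qed.

Lemma primB : Word.prim (stl tl v0) (shd hd v0) v0 cB.
Proof.
case/and3P: hc => h1 h2 h3; apply/and3P; split.
- by rewrite /cB; case: (c) h1.
- have : forall w x y, wpath x w y -> swpath x (map (fun a => [:: a]) w) y.
    by elim=> //= a w IH x y /andP[-> /IH].
  exact.
- by rewrite /cB -map_comp.
Qed.

Lemma mapB : map (stl tl v0) cB = map tl c.
Proof. by rewrite /cB -map_comp. Qed.

Lemma uniqB : uniq cB.
Proof. by case/and3P: hc => _ _ /map_uniq h; rewrite map_inj_uniq // => a b []. Qed.

Lemma countB l g : all segm l -> g \in c -> count_mem g (flatten l) = count_mem [:: g] l.
Proof. by move=> hl /c_ends[h1 h2]; apply: count_single hl h1 h2. Qed.

(** In the quiver of pieces all vertices lie on the cycle, which is the vertex condition of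
    [rearrange]. *)
Lemma seg_rearrange x y l l' : all segm l -> swpath x l y -> swpath x l' y -> perm_eq l l' ->
  (forall g, g \in c -> 1 < count_mem g (flatten l)) -> eqv (flatten l) (flatten l').
Proof.
move=> hl h h' hp hdup; apply: (flat_eqv hl).
apply: (rearrange primB h h' hp) => [s hs|g /mapP[a ha ->]].
  by rewrite mapB; have /and5P[_ _ h1 h2 _] := allP hl s hs; apply/andP.
by rewrite -countB // hdup.
Qed.

Lemma all_segm_perm l l' : perm_eq l l' -> all segm l = all segm l'.
Proof. by move=> h; apply: perm_all. Qed.

(** The arrows of [c] are repeated only in the whole word, so the rearranged part is extended on
    both sides to the outermost visits to [C]. *)
Lemma seg_rearrange_in X Y P be x y l l' : wpath X P x -> wpath y be Y -> C x -> C y ->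
  all segm l -> swpath x l y -> swpath x l' y -> perm_eq l l' ->
  (forall g, g \in c -> 1 < count_mem g (P ++ flatten l ++ be)) ->
  eqv (P ++ flatten l ++ be) (P ++ flatten l' ++ be).
Proof.
move=> hP hbe hx hy hl h h' hp hdup.
have [P0 [P1 [x' [eP h1 h2 h3 h4]]]] := decomp_left hP hx.
have [b1 [b0 [y' [eb h5 h6 h7 h8]]]] := decomp_right hbe hy.
have [lP [elP alP pP]] := cut v0 h2 h3 hx.
have [lb [elb alb pb]] := cut v0 h5 hy h7.
have : eqv (flatten (lP ++ l ++ lb)) (flatten (lP ++ l' ++ lb)).
  apply: (@seg_rearrange x' y').
  - by rewrite !all_cat alP hl alb.
  - by apply: wpath_cat pP _; apply: wpath_cat h pb.
  - by apply: wpath_cat pP _; apply: wpath_cat h' pb.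
  - by rewrite perm_cat2l perm_cat2r.
  - move=> g gc; have := hdup g gc; have [c1 c2] := c_ends gc.
    rewrite eP eb elP elb !flatten_cat !count_cat.
    have -> : count_mem g P0 = 0 by apply/count_memPn/negP => /h4; rewrite c1.
    have -> : count_mem g b0 = 0 by apply/count_memPn/negP => /h8; rewrite c2.
    by clia.
move=> /(eqv_cat P0 b0); rewrite eP eb elP elb !flatten_cat -!catA; exact.
Qed.

Lemma two_copies l : all segm l -> (forall g, g \in c -> 1 < count_mem g (flatten l)) ->
  exists D, perm_eq l (cB ++ cB ++ D).
Proof.
move=> hl hdup; have [D hD] : exists D, perm_eq l ((cB ++ cB) ++ D); last by exists D; rewrite catA.
apply: sub_perm => s; rewrite count_cat; case hs : (s \in cB); last first.
  by rewrite (count_memPn (negbT hs)).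
rewrite (count_uniq_mem _ uniqB) hs; case/mapP: hs => g gc ->.
by rewrite -countB // hdup.
Qed.

Lemma bal_cB x : bal (stl tl v0) (shd hd v0) x cB x.
Proof. by case/and3P: primB => _ /bal_path h _; apply: bal_any h. Qed.

Lemma segm_ends l s : all segm l -> s \in l ->
  (stl tl v0 s \in map (stl tl v0) cB) && (shd hd v0 s \in map (stl tl v0) cB).
Proof. by rewrite mapB => hl hs; have /and5P[_ _ h1 h2 _] := allP hl s hs; apply/andP. Qed.

(** Two copies of [c] are set aside and [p] is a trail from [x] to [y] in the other pieces. The
    remaining pieces and the two copies form a circuit [U] at [x] by [euler]. *)
Lemma split_double x N y : wpath x N y -> C x -> C y ->
  (forall g, g \in c -> 1 < count_mem g N) ->
  exists U p, [/\ eqv N (U ++ p), wpath x U x, wpath x p y & forall g, g \in c -> 1 < count_mem g U].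
Proof.
move=> h hx hy hdup; have [l [el al pl]] := cut v0 h hx hy.
rewrite el in hdup *.
have [D hD] := two_copies al hdup.
have hbD : bal (stl tl v0) (shd hd v0) x D y.
  by apply: (bal_cat (bal_cB x)); apply: (bal_cat (bal_cB x)); apply: bal_perm hD (bal_path pl).
have [p [D' [h1 h2 h3]]] := trail hbD.
have aD : all segm (cB ++ cB ++ D) by rewrite -(all_segm_perm hD).
have [W hW1 hW2] : exists2 W, perm_eq W (cB ++ (cB ++ D')) & swpath x W x.
  apply: (euler primB (bal_cat2 (bal_cB x) h3)); first by rewrite mapB.
  move=> s hs; apply: (segm_ends aD); move: hs; rewrite !mem_cat (perm_mem h1) mem_cat.
  by case/orP=> ->; rewrite ?orbT.
have hp : perm_eq l (W ++ p).
  apply/permP => X; move/permP/(_ X): hD; move/permP/(_ X): h1; move/permP/(_ X): hW1.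
  by rewrite !count_cat; clia.
have aWp : all segm (W ++ p) by rewrite -(all_segm_perm hp).
move: (aWp); rewrite all_cat => /andP[aW ap].
exists (flatten W), (flatten p); split.
- rewrite -flatten_cat; apply: (seg_rearrange al pl _ hp hdup); exact: wpath_cat hW2 h2.
- exact: flat_path aW hW2.
- exact: flat_path ap h2.
- move=> g gc; rewrite countB // (permP hW1) !count_cat.
  have : [:: g] \in cB by rewrite map_f.
  by rewrite -has_pred1 has_count; clia.
Qed.
End Cyc.

(** * Primitive cycles with an arrow that occurs only once *)

Lemma nat_min (P : nat -> Prop) : (exists k, P k) -> exists2 k, P k & forall j, P j -> k <= j.
Proof.
case=> k; have [n] := ubnP k; elim: n k => // n IH k hk hP.
case: (classic (exists2 j, P j & j < k)) => [[j hj hjk]|h].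
  by apply: (IH j) => //; apply: leq_trans hjk _.
by exists k => // j hj; rewrite leqNgt; apply/negP => hlt; apply: h; exists j.
Qed.

Section PrivateCycle.
Variables (V A : eqType) (tl hd : A -> V).
Implicit Types (x y v : V) (a b g : A) (u w p q c z : seq A).
Notation wpath := (wpath tl hd).
Notation eqv := (eqv tl hd).
Notation prim := (prim tl hd).
Notation nz := (nz tl hd).
Notation verts := (verts hd).

Lemma verts_tl x u y : wpath x u y -> verts x u = rcons (map tl u) y.
Proof.
rewrite /Word.verts; elim: u x => [|a u IH] x /=; first by move=> /eqP->.
by case/andP=> /eqP-> /IH->.
Qed.

Lemma closed_perm v u : wpath v u v -> perm_eq (map tl u) (map hd u).
Proof.
move=> h; rewrite -(perm_cons v); have := verts_tl h; rewrite /Word.verts => ->.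
by rewrite perm_sym perm_rcons.
Qed.

(** The shortest suffix that repeats a vertex repeats its first one, and the closed word up to that
    return is primitive. *)
Lemma has_prim x u y : wpath x u y -> ~~ uniq (verts x u) ->
  exists al c be v, [/\ u = al ++ c ++ be, wpath x al v, prim v c & wpath v be y].
Proof.
elim: u x => [|a u IH] x //; rewrite wpath_cons => /andP[/eqP ha h].
case E : (uniq (verts (hd a) u)) => hn; last first.
  have [al [c [be [v [-> h1 h2 h3]]]]] := IH _ h (negbT E).
  by exists (a :: al), c, be, v; split=> //=; rewrite ha eqxx.
have hx : x \in verts (hd a) u by move: hn; rewrite /Word.verts /= in E *; rewrite E andbT negbK.
have [u1 [u2 [e h1 h2]]] := vertsE h hx.
have h3 : wpath x (a :: u1) x by rewrite wpath_cons ha eqxx.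
exists [::], (a :: u1), u2, x; split=> //; rewrite ?e //= ?eqxx //.
apply/and3P; split=> //; rewrite (perm_uniq (closed_perm h3)).
by move: E; rewrite /Word.verts e -[hd a :: _]/(map hd (a :: (u1 ++ u2))) -cat_cons map_cat cat_uniq => /andP[].
Qed.

Lemma closed_nonuniq v u : wpath v u v -> u != [::] -> ~~ uniq (verts v u).
Proof.
move=> h; rewrite (verts_tl h); case: u h => // a u /= /andP[/eqP-> _] _.
by rewrite mem_rcons mem_head.
Qed.

Section Cyc.
Variables (v0 : V) (c : seq A).
Hypothesis hc : prim v0 c.
Notation C := (mem (map tl c)).

(** Both orders consist of the same pieces; the repeated arrows of [c] make them equivalent although
    [S] and [S'] need not be closed. *)
Lemma swap_interlaced X Y P S M S' be x t : C x -> C t ->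
  wpath X P x -> wpath x S t -> wpath t M x -> wpath x S' t -> wpath t be Y ->
  (forall g, g \in c -> 1 < count_mem g (P ++ S ++ M ++ S' ++ be)) ->
  eqv (P ++ S ++ M ++ S' ++ be) (P ++ S' ++ M ++ S ++ be).
Proof.
move=> hx ht hP hS hM hS' hbe hdup.
have [lS [eS aS pS]] := cut v0 hS hx ht.
have [lM [eM aM pM]] := cut v0 hM ht hx.
have [lT [eT aT pT]] := cut v0 hS' hx ht.
have := @seg_rearrange_in _ _ tl hd v0 c hc X Y P be x t (lS ++ lM ++ lT) (lT ++ lM ++ lS).
rewrite !flatten_cat -eS -eM -eT -!catA; apply=> //.
- by rewrite !all_cat aS aM aT.
- by apply: wpath_cat pS _; apply: wpath_cat pM pT.
- by apply: wpath_cat pT _; apply: wpath_cat pM pS.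
- by apply/permP => Q; cnt; clia.
Qed.

Lemma flat_hd l v : all (segm tl hd v0 C) l -> v \in map hd (flatten l) -> C v ->
  v \in map (shd hd v0) l.
Proof.
move=> + + hv; elim: l => // s l IH /= /andP[hs hl].
rewrite map_cat mem_cat inE => /orP[|/(IH hl)->]; last by rewrite orbT.
case/and5P: hs => hn hp _ _ hall /mapP[a ha e]; apply/orP; left.
case/lastP: s hn hp hall ha => // s b _ hp.
rewrite size_rcons /= -cats1 take_size_cat // => hall; rewrite mem_cat mem_seq1 => /orP[ha|/eqP ha].
  by have := allP hall a ha; rewrite -e => /negP[].
rewrite -cats1 in hp; have [_ /= /eqP <-] := wpath_mid hp; by rewrite e ha.
Qed.

Lemma flat_nonnil l : all (segm tl hd v0 C) l -> l != [::] -> flatten l != [::].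
Proof. by case: l => // s l /= /andP[/and5P[hs _ _ _ _] _] _; case: s hs. Qed.

(** Two copies of [c] are set aside, leaving pieces [D]. If [D] is empty, the word is a square up to
    equivalence. If a piece of [D] starts at [w], a closed trail at [w] splits off. Otherwise a
    closed trail in [D] misses [w]. *)
Lemma full_closed u (w : V) : wpath w u w -> C w -> (forall g, g \in c -> 1 < count_mem g u) ->
  [\/ exists2 r, eqv u (r ++ r) & r != [::] /\ wpath w r w,
      exists U p, [/\ eqv u (U ++ p), wpath w U w, wpath w p w, p != [::]
                    & forall g, g \in c -> 1 < count_mem g U]
    | exists al X be v, [/\ eqv u (al ++ X ++ be), wpath v X v, X != [::] & w \notin verts v X]].
Proof.
move=> h hw hdup; have [l [el al pl]] := cut v0 h hw hw.
rewrite el in hdup *.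
have [D hD] := two_copies hc al hdup.
have hpB := primB hc.
have hbD : bal (stl tl v0) (shd hd v0) w D w.
  by apply: (bal_cat (bal_cB hc w)); apply: (bal_cat (bal_cB hc w)); apply: bal_perm hD (bal_path pl).
have aD : all (segm tl hd v0 C) (cB c ++ cB c ++ D) by rewrite -(perm_all _ hD).
have hwB : w \in map (stl tl v0) (cB c) by rewrite mapB.
have rearr l' : perm_eq l l' -> Word.wpath (stl tl v0) (shd hd v0) w l' w ->
    eqv (flatten l) (flatten l').
  by move=> hp hp'; apply: (seg_rearrange hc al pl hp' hp hdup).
case: D hD hbD aD => [|s D0] hD hbD aD.
  have [c' [/and3P[hn hc1 _] hc2]] := prim_at hpB hwB.
  have hp : perm_eq l (c' ++ c').
    by apply: perm_trans hD _; rewrite cats0; apply: perm_cat; rewrite perm_sym.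
  have ac : all (segm tl hd v0 C) c'.
    by move: aD; rewrite !all_cat => /andP[h1 _]; rewrite (perm_all _ hc2).
  apply: Or31; exists (flatten c'); last by split; [apply: flat_nonnil | apply: flat_path ac hc1].
  by rewrite -flatten_cat; apply: rearr => //; exact: (wpath_cat hc1 hc1).
set D := s :: D0 in hD hbD aD.
(* A closed trail [X] through [s'] inside [D], and a circuit [W] at [w] of all other pieces, both
   copies of [c] included. *)
have go s' : s' \in D -> exists W X, [/\ perm_eq l (W ++ X), Word.wpath (stl tl v0) (shd hd v0) w W w,
    Word.wpath (stl tl v0) (shd hd v0) (stl tl v0 s') X (stl tl v0 s'), s' \in X /\ {subset X <= D}
    & forall g, g \in c -> 1 < count_mem [:: g] W].
  move=> hs'; have [p [D' [h1 h2 h3]]] := trail_through hbD hs'.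
  have [W hW1 hW2] : exists2 W, perm_eq W (cB c ++ (cB c ++ D')) & Word.wpath (stl tl v0) (shd hd v0) w W w.
    apply: (euler hpB (bal_cat2 (bal_cB hc w) h3) hwB).
    move=> t ht; apply: (segm_ends aD); move: ht; rewrite !mem_cat (perm_mem h1) mem_cat.
    by case/orP=> ->; rewrite ?orbT.
  exists W, (s' :: p); split=> //.
  - apply/permP => Q; move/permP/(_ Q): hD; move/permP/(_ Q): h1; move/permP/(_ Q): hW1.
    by cnt; clia.
  - by split; [rewrite mem_head | move=> t ht; rewrite (perm_mem h1) mem_cat ht].
  - move=> g gc; rewrite (permP hW1) !count_cat.
    have : [:: g] \in cB c by rewrite map_f.
    by rewrite -has_pred1 has_count; clia.
have aWX W X : perm_eq l (W ++ X) -> all (segm tl hd v0 C) W /\ all (segm tl hd v0 C) X.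
  by move=> h1; move: al; rewrite (perm_all _ h1) all_cat => /andP.
have nX s' (X : seq (seq A)) : s' \in X -> X != [::] by case: X.
case E : (has (fun t => stl tl v0 t == w) D).
  case/hasP: E => t ht /eqP et; have [W [X [h1 h2 h3 [h4 _] h5]]] := go t ht.
  rewrite et in h3; have [aW aX] := aWX _ _ h1.
  apply: Or32; exists (flatten W), (flatten X); split.
  - by rewrite -flatten_cat; apply: rearr => //; apply: wpath_cat h2 h3.
  - exact: flat_path aW h2.
  - exact: flat_path aX h3.
  - by apply: flat_nonnil aX _; apply: nX h4.
  - by move=> g gc; rewrite (countB hc aW gc); apply: h5.
have [W [X [h1 h2 h3 [h4 h5] h6]]] := go s (mem_head _ _).
have [aW aX] := aWX _ _ h1.
have hs : stl tl v0 s \in map (stl tl v0) W.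
  have /mapP[g gc e] : stl tl v0 s \in map tl c.
    by rewrite -(mapB tl v0 c); have /andP[] := segm_ends aX h4.
  rewrite e -[tl g]/(stl tl v0 [:: g]); apply: map_f.
  by rewrite -has_pred1 has_count; apply: ltnW; apply: h6.
have [W1' [W2' [eW _ /(_ _ _ h2)[h7 h8]]]] := @splitT _ _ _ (shd hd v0) _ _ hs.
have [aW1 aW2] : all (segm tl hd v0 C) W1' /\ all (segm tl hd v0 C) W2'.
  by move: aW; rewrite eW all_cat => /andP.
apply: Or33; exists (flatten W1'), (flatten X), (flatten W2'), (stl tl v0 s); split.
- rewrite -!flatten_cat; apply: rearr; last by apply: wpath_cat h7 _; apply: wpath_cat h3 h8.
  by apply/permP => Q; move/permP/(_ Q): h1; rewrite eW; cnt; clia.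
- exact: flat_path aX h3.
- by apply: flat_nonnil aX _; apply: nX h4.
rewrite (verts_tl (flat_path aX h3)) mem_rcons inE.
have hno t : t \in X -> stl tl v0 t != w.
  by move=> /h5 ht; apply/negP => ht'; move/hasP: E; apply; exists t.
rewrite eq_sym negb_or hno //=; apply/negP.
rewrite -(closed_hd (flat_path aX h3)) => /(flat_hd aX)/(_ hw).
by rewrite (closed_hd h3) => /mapP[t /hno + e]; rewrite -e eqxx.
Qed.
End Cyc.

(** [U] is a closed factor in which [c] leaves the order of pieces free; the descent minimises its
    length [k]. *)
Definition form u x y (c : seq A) k := exists al U be v,
  [/\ eqv u (al ++ U ++ be) /\ size U = k, wpath x al v /\ wpath v be y, wpath v U v,
      v \in map tl c & forall g, g \in c -> 1 < count_mem g U].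

Lemma form_sub u x y v0 c p (N : seq A) q v (w : V) : prim v0 c -> eqv u (p ++ N ++ q) -> wpath x p v -> wpath v N w ->
  wpath w q y -> v \in map tl c -> w \in map tl c ->
  (forall g, g \in c -> 1 < count_mem g N) -> exists2 k, form u x y c k & k <= size N.
Proof.
move=> hc h h1 h2 h3 hv hw hdup.
have [U [r [h4 h5 h6 h7]]] := split_double hc h2 hv hw hdup.
exists (size U); last by rewrite (eqv_size h4) size_cat leq_addr.
exists p, U, (r ++ q), v; split=> //; split=> //; last exact: wpath_cat h6 h3.
by apply: eqv_trans h _; apply: eqv_trans (eqv_cat p q h4) _; apply: eqvE; lsolve.
Qed.

(** The stretch from the first to the last visit to [c] contains all arrows of [c] in the word;
    [form_sub] extracts a closed factor. *)
Lemma form_exists u x y v0 c : wpath x u y -> prim v0 c ->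
  (forall g, g \in c -> 1 < count_mem g u) -> exists k, form u x y c k.
Proof.
move=> hu hc hdup; have [g gc] : exists g, g \in c.
  by case/and3P: hc; case: (c) => // g c' _ _ _; exists g; rewrite mem_head.
have /splitS[u1 [u2 e]] : g \in u by rewrite -has_pred1 has_count; apply: ltnW; apply: hdup.
have hg := c_ends hc gc; rewrite e in hu; have [h1 h2] := wpath_mid hu.
have h3 : wpath (tl g) (g :: u2) y by rewrite /= eqxx.
have [p0 [p1 [x' [e1 k1 k2 k3 k4]]]] := decomp_left h1 hg.1.
have [q1 [q0 [y' [e2 k5 k6 k7 k8]]]] := decomp_right h3 hg.1.
have h4 : eqv u (p0 ++ (p1 ++ q1) ++ q0) by apply: eqvE; rewrite e e1 e2; lsolve.
have dN k : k \in c -> 1 < count_mem k (p1 ++ q1).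
  move=> kc; have := hdup k kc; have [c1 c2] := c_ends hc kc.
  rewrite e e1 e2 !count_cat.
  have -> : count_mem k p0 = 0 by apply/count_memPn/negP => /k4; rewrite c1.
  have -> : count_mem k q0 = 0 by apply/count_memPn/negP => /k8; rewrite c2.
  by clia.
have [k hk _] := form_sub hc h4 k1 (wpath_cat k2 k5) k6 k3 k7 dN.
by exists k.
Qed.

Section Step.
Variables (u : seq A) (x y : V).
Hypotheses (hu : wpath x u y) (hnz : nz u).
(** [IH] is [private_cycle] for shorter closed words, and [H] denies its conclusion for [u]. *)
Hypothesis IH : forall w v, size w < size u -> wpath v w v -> nz w -> w != [::] ->
  exists al z be t e, [/\ eqv w (al ++ z ++ be), wpath v al t, prim t z, e \in z & count_mem e w = 1].
Hypothesis H : forall al z be t g, eqv u (al ++ z ++ be) -> prim t z -> g \in z -> 1 < count_mem g u.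

(* By minimality [U] contains a cycle [z] with an arrow [e] that occurs once in [U], hence also
   outside [U]; sliding [z] to that other place leaves a smaller form. *)
Lemma minimal_form_absurd v0 c k : prim v0 c -> form u x y c k ->
  (forall j, form u x y c j -> k <= j) -> k < size u -> False.
Proof.
move=> hc [al [U [be [v [[hU <-] [hal hbe] hUv hv hdup]]]]] hmin hlt.
have c0 : exists g, g \in c.
  by case/and3P: hc; case: (c) => // g c' _ _ _; exists g; rewrite mem_head.
have Un : U != [::] by case: c0 => g /hdup; case: (U).
have nzU : nz U by apply: nz_sub (nz_eqv hU hnz).
have [a1 [z [b1 [t [e [h1 h2 hz he hce]]]]]] := IH hlt hUv nzU Un.
have y0 : eqv u (al ++ a1 ++ z ++ b1 ++ be).
  by apply: eqv_trans hU _; apply: eqv_trans (eqv_cat al be h1) _; apply: eqvE; lsolve.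
have hzd g : g \in z -> 1 < count_mem g u.
  by apply: (H (al := al ++ a1) (be := b1 ++ be) (t := t)) => //; apply: eqv_trans y0 _; apply: eqvE; lsolve.
have ec : e \notin c by apply/negP => /hdup; rewrite hce.
have zz : wpath t z t by case/and3P: hz.
have uz : uniq z by case/and3P: hz => _ _ /map_uniq.
have hb1 : wpath t b1 v.
  have := eqv_wpath h1 hUv => /wpathP[t' k1 /wpathP[t'' k2 k3]].
  have e1 := wpath_end h2 k1; rewrite -e1 in k2; by rewrite (wpath_end zz k2).
have [z1 [z2 ez]] := splitS he.
have [hz1 hz2] : wpath t z1 (tl e) /\ wpath (hd e) z2 t by apply: wpath_mid; rewrite -ez.
set w := al ++ a1 ++ b1 ++ be.
have hw : wpath x w y.
  by apply: wpath_cat hal _; apply: wpath_cat h2 _; apply: wpath_cat hb1 hbe.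
have cw g : count_mem g u = count_mem g w + count_mem g z.
  by rewrite (permP (eqv_perm y0)) /w; cnt; clia.
have cz g : count_mem g z <= 1 by rewrite (count_uniq_mem _ uz); case: (g \in z).
have z1w : {subset z1 <= w}.
  move=> g hg; have gz : g \in z by rewrite ez mem_cat hg.
  by rewrite -has_pred1 has_count; have := hzd g gz; rewrite cw; have := cz g; clia.
set O := a1 ++ b1.
have hO : wpath v O v by apply: wpath_cat h2 hb1.
have cU g : count_mem g U = count_mem g O + count_mem g z.
  by rewrite (permP (eqv_perm h1)) /O; cnt; clia.
have sU : size U = size O + size z.
  by rewrite (eqv_size h1) /O !size_cat; clia.
have zt : wpath (tl e) (e :: z2 ++ z1) (tl e).
  by rewrite /= eqxx /=; apply: wpath_cat hz2 hz1.
have pz : perm_eq z (e :: z2 ++ z1) by rewrite ez -cat_cons perm_catC.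
(* [e] occurs once in [U] but at least twice in [u]. *)
have heab : e \in al ++ be.
  have ez1 := cz e; have hou := hzd e he; rewrite -has_pred1 has_count.
  move: hou hce; rewrite cw cU /w /O; cnt.
  have : 0 < count_mem e z by rewrite -has_count has_pred1.
  by clia.
(* The arrows of [z1] occur in [w], so [z] slides along [z1] to any occurrence of [e] in [w]. *)
have moved A1 A2 : w = A1 ++ e :: A2 -> eqv u (A1 ++ (e :: z2 ++ z1) ++ e :: A2).
  move=> ew; apply: eqv_trans y0 _.
  have hA1 : wpath x A1 (tl e) by move: hw; rewrite ew => /wpath_mid[].
  have := @slide _ _ tl hd x y w z1 (e :: z2) t (tl e) (al ++ a1) (b1 ++ be) A1 (e :: A2) hw hz1.
  have -> : al ++ a1 ++ z ++ b1 ++ be = (al ++ a1) ++ (z1 ++ e :: z2) ++ b1 ++ be by rewrite ez; lsolve.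
  by apply=> //; [rewrite /= eqxx | rewrite /w; lsolve | exact: wpath_cat hal h2].
(* If [z] misses the vertices of [c], then [O], which is [U] without [z], still repeats all arrows
   of [c] and is shorter. *)
case hzC : (has (fun g => tl g \in map tl c) z); last first.
  have gz g : g \in c -> count_mem g z = 0.
    move=> gc; apply/count_memPn/negP => gz; move/hasP: hzC; apply; exists g => //; exact: map_f.
  have sz : 0 < size z by rewrite ez size_cat /= addnS.
  suff [j hj1 hj2] : exists2 j, form u x y c j & j = size O.
    by have := hmin _ hj1; rewrite hj2 sU; move: sz; clia.
  have dO g : g \in c -> 1 < count_mem g O by move=> gc; have := hdup g gc; rewrite cU gz // addn0.
  exists (size O) => //; move: heab; rewrite mem_cat => /orP[/splitS[A1 [A2 eA]]|/splitS[A1 [A2 eA]]].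
    exists (A1 ++ (e :: z2 ++ z1) ++ e :: A2), O, be, v; split=> //.
      split=> //; apply: eqv_trans (moved A1 (A2 ++ a1 ++ b1 ++ be) _) _; first by rewrite /w eA; lsolve.
      by apply: eqvE; rewrite /O; lsolve.
    split=> //; rewrite eA in hal; have [k1 k2] := wpath_mid hal.
    by apply: wpath_cat k1 _; apply: wpath_cat zt _; rewrite /= eqxx.
  exists al, O, (A1 ++ (e :: z2 ++ z1) ++ e :: A2), v; split=> //.
    split=> //; apply: eqv_trans (moved (al ++ a1 ++ b1 ++ A1) A2 _) _; first by rewrite /w eA; lsolve.
    by apply: eqvE; rewrite /O; lsolve.
  split=> //; rewrite eA in hbe; have [k1 k2] := wpath_mid hbe.
  by apply: wpath_cat k1 _; apply: wpath_cat zt _; rewrite /= eqxx.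
have hzr : wpath (hd e) (z2 ++ z1) (tl e) by apply: wpath_cat hz2 hz1.
have [p0 hp0 cp0] : exists2 p : V, p \in verts (hd e) (z2 ++ z1) & p \in map tl c.
  case/hasP: hzC => g; rewrite (perm_mem pz) inE => /orP[/eqP->|hg] hgc.
    by exists (tl e) => //; rewrite (verts_tl hzr) mem_rcons mem_head.
  by exists (tl g) => //; apply: tl_verts hzr hg.
have [r1 [r2 [er k1 k2]]] := vertsE hzr hp0.
(* After [e], the cycle [z] first meets [c] at [p] and last at [q]; only the part [kp] in between
   can contain arrows of [c]. *)
have [P0 [P1 [p [eP k3 k4 k5 k6]]]] := decomp_left k1 cp0.
have [Q1 [Q0 [q [eQ k7 k8 k9 k10]]]] := decomp_right k2 cp0.
set s2 := e :: P0; set kp := P1 ++ Q1.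
have ezt : e :: z2 ++ z1 = s2 ++ kp ++ Q0 by rewrite er eP eQ /s2 /kp; lsolve.
have hs2 : wpath (tl e) s2 p by rewrite /s2 /= eqxx.
have hkp : wpath p kp q by apply: wpath_cat k4 k7.
have cN g : g \in c -> count_mem g U = count_mem g O + count_mem g kp.
  move=> gc; have [c1 c2] := c_ends hc gc.
  rewrite cU (permP pz) ezt !count_cat /s2 /=.
  have -> : (e == g) = false by apply/negbTE/eqP => eg; rewrite eg gc in ec.
  have -> : count_mem g P0 = 0 by apply/count_memPn/negP => /k6/negP[].
  have -> : count_mem g Q0 = 0 by apply/count_memPn/negP => /k10/negP[].
  by rewrite !add0n addn0.
have [o1 [o2 [eO ho1 ho2]]] : exists o1 o2, [/\ O = o1 ++ o2, wpath v o1 p & wpath p o2 v].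
  case/mapP: (k5) => g gc ep; rewrite ep; apply: (vertsE hO); apply: (tl_verts hO).
  by rewrite -has_pred1 has_count; have := hdup g gc; rewrite cU; have := cz g; clia.
have hN : wpath p (o2 ++ o1 ++ kp) q by apply: wpath_cat ho2 _; apply: wpath_cat ho1 hkp.
have dN g : g \in c -> 1 < count_mem g (o2 ++ o1 ++ kp).
  by move=> gc; have := hdup g gc; rewrite (cN g gc) eO; cnt; clia.
have sN : size (o2 ++ o1 ++ kp) < size U.
  by rewrite sU (perm_size pz) ezt eO !size_cat /s2 /=; clia.
(* [O] rotated to start at [p], followed by [kp], repeats all arrows of [c] and lacks at least [e]
   compared with [U]. An interlaced exchange makes it a factor. *)
suff [P [Q [h5 h6 h7]]] : exists P Q, [/\ eqv u (P ++ (o2 ++ o1 ++ kp) ++ Q), wpath x P p & wpath q Q y].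
  have [j hj1 hj2] := form_sub hc h5 h6 hN h7 k5 k9 dN.
  by have := hmin _ hj1; move: hj2 sN; clia.
have ddup g z' : g \in c -> eqv u z' -> 1 < count_mem g z'.
  move=> gc hz'; rewrite -(permP (eqv_perm hz')) (permP (eqv_perm hU)) !count_cat.
  by have := hdup g gc; clia.
move: heab; rewrite mem_cat => /orP[/splitS[A1 [A2 eA]]|/splitS[A1 [A2 eA]]].
  rewrite eA in hal; have [k11 k12] := wpath_mid hal.
  have h5 : eqv u ((A1 ++ s2) ++ (kp ++ Q0 ++ e :: A2) ++ o1 ++ o2 ++ be).
    apply: eqv_trans (moved A1 (A2 ++ a1 ++ b1 ++ be) _) _; first by rewrite /w eA; lsolve.
    by apply: eqvE; rewrite ezt -[e :: (A2 ++ _)]/((e :: A2) ++ _) [a1 ++ _]catA -/O eO; lsolve.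
  have hS : wpath p (kp ++ Q0 ++ e :: A2) v.
    by apply: wpath_cat hkp _; apply: wpath_cat k8 _; rewrite /= eqxx.
  have hP : wpath x (A1 ++ s2) p by apply: wpath_cat k11 hs2.
  exists (A1 ++ s2), (Q0 ++ e :: A2 ++ be); split=> //.
    apply: (eqv_trans h5).
    apply: eqv_trans (@swap_interlaced v0 c hc x y _ _ _ _ _ p v k5 hv hP hS ho1 ho2 hbe _) _.
      by move=> g gc; apply: ddup gc h5.
    by apply: eqvE; lsolve.
  apply: wpath_cat k8 _; rewrite /= eqxx /=; exact: wpath_cat k12 hbe.
rewrite eA in hbe; have [k11 k12] := wpath_mid hbe.
have h5 : eqv u (al ++ o1 ++ o2 ++ (A1 ++ s2) ++ (kp ++ Q0 ++ e :: A2)).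
  apply: eqv_trans (moved (al ++ a1 ++ b1 ++ A1) A2 _) _; first by rewrite /w eA; lsolve.
  apply: eqvE; have -> : al ++ o1 ++ o2 ++ (A1 ++ s2) ++ kp ++ Q0 ++ e :: A2
     = al ++ (o1 ++ o2) ++ (A1 ++ s2) ++ kp ++ Q0 ++ e :: A2 by lsolve.
  by rewrite -eO ezt /O; lsolve.
have hS : wpath v (A1 ++ s2) p by apply: wpath_cat k11 hs2.
have hR : wpath p (kp ++ Q0 ++ e :: A2) y.
  by apply: wpath_cat hkp _; apply: wpath_cat k8 _; rewrite /= eqxx.
exists (al ++ A1 ++ s2), (Q0 ++ e :: A2); split.
- apply: (eqv_trans h5).
  apply: eqv_trans (@swap_interlaced v0 c hc x y _ _ _ _ _ v p hv k5 hal ho1 ho2 hS hR _) _.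
    by move=> g gc; apply: ddup gc h5.
  by apply: eqvE; lsolve.
- exact: wpath_cat hal hS.
- by apply: wpath_cat k8 _; rewrite /= eqxx.
Qed.

(** A minimal form shorter than [u] is excluded, so it is all of [u], closed at [x]. Of the cases of
    [full_closed], a square contradicts [nz], a split-off part contradicts minimality, and a closed
    factor missing [x] contains a primitive [z] whose forms, based away from [x], are shorter than
    [u]. *)
Lemma all_double_absurd : ~~ uniq (verts x u) -> False.
Proof.
move=> hn; have [al [c [be [v0 [eu hal hc hbe]]]]] := has_prim hu hn.
have hdup g : g \in c -> 1 < count_mem g u by apply: H hc; apply: eqvE eu.
have [k hk hmin] := nat_min (form_exists hu hc hdup).
case: (ltnP k (size u)) => hlt; first exact: minimal_form_absurd hc hk hmin hlt.
case: hk => al1 [U [be1 [v [[hU sU] [k1 k2] k3 hv hdU]]]].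
have := eqv_size hU; rewrite !size_cat sU => hs.
have eal : al1 = [::] by apply/nilP; rewrite /nilp; move: hs hlt; clia.
have ebe : be1 = [::] by apply/nilP; rewrite /nilp; move: hs hlt; clia.
rewrite {}eal {}ebe /= cats0 in hU k1 k2; move/eqP: k1 => k1; subst v; move/eqP: k2 => exy.
case: (full_closed hc k3 hv hdU) => [[r h1 [hr1 hr2]]|[U' [p [h1 h2 h3 hp h4]]]|[al' [X [be' [v [h1 h2 h3 h4]]]]]].
- case/eqP: hr1; apply: (hnz (al := [::]) (be := [::]) _ hr2) => /=; rewrite cats0.
  exact: eqv_trans hU h1.
- have : k <= size U'.
    apply: hmin; exists [::], U', p, x; split=> //; split=> //=; last by rewrite -exy.
    exact: eqv_trans hU h1.
  have : 0 < size p by case: (p) hp.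
  by rewrite -sU (eqv_size h1) size_cat; clia.
have [a2 [z [b2 [t [eX g1 hz g2]]]]] := has_prim h2 (closed_nonuniq h2 h3).
have hz' : eqv u ((al' ++ a2) ++ z ++ (b2 ++ be')).
  by apply: eqv_trans hU _; apply: eqv_trans h1 _; apply: eqvE; rewrite eX; lsolve.
have hzd g : g \in z -> 1 < count_mem g u by apply: H hz' hz.
have [k' hk' hmin'] := nat_min (form_exists hu hz hzd).
apply: (minimal_form_absurd hz hk' hmin').
case: hk' => al3 [U1 [be3 [t1 [[hU1 <-] [f1 f2] f3 ht1 _]]]].
rewrite (eqv_size hU1) !size_cat; case: al3 f1 {hU1} => [|a al3]; last by move=> _ /=; clia.
move=> /= /eqP et; case/mapP: ht1 => g gz eg.
case/negP: h4; rewrite et eg; apply: tl_verts h2 _; by rewrite eX !mem_cat gz orbT.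
Qed.
End Step.

Theorem private_cycle u x y : wpath x u y -> nz u -> ~~ uniq (verts x u) ->
  exists al c be v e, [/\ eqv u (al ++ c ++ be), wpath x al v, prim v c, e \in c & count_mem e u = 1].
Proof.
have [n] := ubnP (size u); elim: n u x y => // n IH u x y hsz hu hnz hn.
apply: NNPP => hno; apply: (all_double_absurd hu hnz _ _ hn).
  move=> w v hw h1 h2 h3; apply: (IH w v v) => //; last exact: closed_nonuniq h1 h3.
  by apply: leq_trans hw _.
move=> al z be t g h1 hz hg; rewrite ltnNge; apply/negP => hle; apply: hno.
have h2 := eqv_wpath h1 hu; exists al, z, be, t, g; split=> //.
  case/wpathP: h2 => t' h3 /wpathP[t'' h4 h5].
  suff -> : t = t' by []. case/and3P: hz h4 {hg h1}; case: (z) => // b z' _ /= /andP[/eqP<- _] _.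
  by case/andP=> /eqP<-.
apply/eqP; rewrite eqn_leq hle /= -has_count has_pred1.
by rewrite (perm_mem (eqv_perm h1)) !mem_cat hg orbT.
Qed.
End PrivateCycle.

(** * Numbers of distinct entries and of entries that occur once *)

Section Counting.
Variable T : eqType.
Implicit Types (s t : seq T).

Definition num_distinct s := size (undup s).
Definition num_once s := count [pred x | count_mem x s == 1] s.

Lemma num_distinct_perm s t : perm_eq s t -> num_distinct s = num_distinct t.
Proof. by move=> h; apply/perm_size/perm_undup/perm_mem. Qed.

Lemma num_once_perm s t : perm_eq s t -> num_once s = num_once t.
Proof.
move=> h; rewrite /num_once (permP h); apply: eq_count => x /=; by rewrite (permP h).
Qed.

Lemma num_distinct_cat s t : uniq t -> num_distinct (s ++ t) = num_distinct s + count [predC s] t.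
Proof.
rewrite (num_distinct_perm (permEl (perm_catC s t))) /num_distinct; elim: t => [|x t IH] /=; first by rewrite addn0.
case/andP=> hx /IH e; rewrite mem_cat (negbTE hx) /=.
by case: (x \in s) => /=; rewrite e; clia.
Qed.

Lemma num_distinct_uniq s : uniq s -> num_distinct s = size s.
Proof. by rewrite /num_distinct => /undup_id->. Qed.

Lemma num_once_uniq s : uniq s -> num_once s = size s.
Proof.
move=> h; apply/eqP; rewrite -all_count; apply/allP => x hx /=.
by rewrite count_uniq_mem // hx.
Qed.

Lemma count_sum (P Q R : pred T) s :
  (forall x, (P x : nat) = Q x + R x) -> count P s = count Q s + count R s.
Proof. by move=> h; elim: s => //= x s ->; rewrite h; clia. Qed.

Lemma num_once_cons x s : num_once (x :: s) + (count_mem x s == 1) = num_once s + (x \notin s).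
Proof.
rewrite /num_once /= eqxx; case hx : (x \in s) => /=; last first.
  have -> : count_mem x s = 0 by apply/count_memPn; rewrite hx.
  rewrite /= addn0 addnC; congr addn; apply: eq_in_count => y hy /=.
  by case: (x =P y) => // e; move: hy; rewrite -e hx.
have h0 : 0 < count_mem x s by rewrite -has_count has_pred1.
have -> : (1 + count_mem x s == 1) = false by move: h0; case: (count_mem x s).
set b := count_mem x s == 1; have hb : b -> count_mem x s = 1 by move/eqP.
rewrite add0n addn0 (@count_sum [pred y | count_mem y s == 1] [pred y | (x == y) + count_mem y s == 1] [pred y | (y == x) && b]) => [|y] /=.
  congr (_ + _); case: b hb => [/(_ isT) e|_].
    by rewrite -[LHS]/1 -e; apply: eq_count => y /=; rewrite andbT.
  by rewrite -[LHS]/0 -(count_pred0 s); apply: eq_count => y /=; rewrite andbF.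
rewrite (eq_sym x y); case: (y =P x) => [->|_] /=; last by rewrite addn0.
by rewrite /b; move: h0; case: (count_mem x s) => [|[|k]].
Qed.

Lemma num_once_cat s t : uniq t ->
  num_once (s ++ t) + count [pred x | count_mem x s == 1] t = num_once s + count [predC s] t.
Proof.
rewrite (num_once_perm (permEl (perm_catC s t))); elim: t => [|x t IH] //= /andP[hx /IH].
have := num_once_cons x (t ++ s); rewrite mem_cat (negbTE hx) count_cat /=.
have -> : count_mem x t = 0 by apply/count_memPn.
by rewrite add0n; case: (x \in s); case: (count_mem x s == 1) => /=; clia.
Qed.
End Counting.

(** * Primitive squares and the transport of inserted closed words *)

Section Squares.
Variables (V A : eqType) (tl hd : A -> V).
Implicit Types (x y v : V) (a b g : A) (u w p q c z : seq A).
Notation wpath := (wpath tl hd).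
Notation eqv := (eqv tl hd).
Notation prim := (prim tl hd).
Notation nz := (nz tl hd).
Notation verts := (verts hd).

(** In a shortest square, let [k] be [k1 c k2] with [c] primitive. Exchanging the first [c] with
    [k2 k1] makes the two copies of [c] adjacent, so [k] is [c] by minimality. *)
Lemma square_prim w : ~ nz w -> exists al k be v, eqv w (al ++ k ++ k ++ be) /\ prim v k.
Proof.
move=> hn.
have [] := @nat_min (fun j => exists al k be v, [/\ eqv w (al ++ k ++ k ++ be), wpath v k v,
  k != [::] & size k = j]).
  apply: NNPP => hno; apply: hn => al k be v h hk; apply/eqP/negPn/negP => kn.
  by apply: hno; exists (size k), al, k, be, v.
move=> j [al [k [be [v [h hk kn <-]]]]] hmin; exists al, k, be.
have [k1 [c [k2 [t [e h1 hc h2]]]]] := has_prim hk (closed_nonuniq hk kn).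
have /and3P[cn hc1 _] := hc.
have := hmin (size c); rewrite {1}e !size_cat => hle.
have {}hle : size k1 + (size c + size k2) <= size c.
  apply: hle; exists (al ++ k1 ++ k2 ++ k1), c, (k2 ++ be), t; split=> //.
  apply: eqv_trans h _; apply: (swapE (al := al ++ k1) (p := c) (q := k2 ++ k1) (be := c ++ k2 ++ be) hc1).
  - exact: wpath_cat h2 h1.
  - by rewrite e; lsolve.
  - by lsolve.
have [/nilP e1 /nilP e2] : nilp k1 /\ nilp k2 by rewrite /nilp; move: hle; clia.
by exists t; rewrite e e1 e2 /= cats0 in h *.
Qed.

(** Induction on the swaps: the inserted [C] is absorbed by whichever of the four factors contains a
    visit to [v], and that factor stays closed if it was. *)
Lemma carry x y v C w w' p q p' q' : wpath v C v -> wpath x w y -> eqv w w' -> w = p ++ q -> w' = p' ++ q' ->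
  wpath x p v -> wpath x p' v -> eqv (p ++ C ++ q) (p' ++ C ++ q').
Proof.
move=> hC hw he ew ew' hp; elim: he p' q' ew' => [|v0 al P Q be h IH hP hQ] p' q' ew' hp'.
  by apply: ins_same hC _ hp hp'; rewrite -ew.
have hz := eqv_wpath h hw.
(* Any visit to [v] in the new word will do, since [ins_same] moves [C] to the prescribed one. *)
suff [p1 [q1 [e1 h1 h2]]] : exists p1 q1, [/\ al ++ Q ++ P ++ be = p1 ++ q1, wpath x p1 v &
    eqv (p ++ C ++ q) (p1 ++ C ++ q1)].
  by apply: eqv_trans h2 _; apply: ins_same hC _ h1 hp'; rewrite -e1.
case: (altP (P =P [::])) => [eP|nP]; first by exists p', q'; split=> //; apply: IH => //; rewrite -ew' eP.
have hal : wpath x al v0.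
  case/wpathP: hz => t h1 /wpathP[t' h2 _]; case: P nP hP h2 {h IH ew'} => // a P _ h3 h2.
  by rewrite -(wpath_start h2 h3).
have hbe : wpath v0 be y by apply: (wpath_catr hQ); apply: (wpath_catr hP); apply: (wpath_catr hal).
have hv : v \in verts x (al ++ P ++ Q ++ be).
  have : v \in verts x p' by apply/(vertsP v hp'); exists p', [::]; rewrite cats0 /= eqxx.
  rewrite /Word.verts !inE => /orP[->//|hv]; apply/orP; right.
  have : v \in map hd (p' ++ q') by rewrite map_cat mem_cat hv.
  by rewrite -ew' !map_cat !mem_cat; do 3 case: (v \in _).
rewrite (verts_cat hal (wpath_cat hP (wpath_cat hQ hbe))) mem_cat in hv.
have sub z t1 t2 : wpath t1 z t2 -> v \in map hd z -> exists z1 z2, [/\ z = z1 ++ z2, wpath t1 z1 v & wpath v z2 t2].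
  by move=> hz' hv'; apply: (vertsE hz'); rewrite inE hv' orbT.
have {}hv : [|| v \in verts x al, v \in map hd P, v \in map hd Q | v \in map hd be].
  by move: hv; rewrite !map_cat !mem_cat.
case/or4P: hv => [/(vertsE hal)|/(sub _ _ _ hP)|/(sub _ _ _ hQ)|/(sub _ _ _ hbe)] [z1 [z2 [ez g1 g2]]].
- exists z1, (z2 ++ Q ++ P ++ be); split=> //; first by rewrite ez; lsolve.
  apply: (eqv_trans (IH z1 (z2 ++ P ++ Q ++ be) _ g1)); first by rewrite ez; lsolve.
  by apply: (swapE (al := z1 ++ C ++ z2) (be := be) hP hQ); lsolve.
- exists (al ++ Q ++ z1), (z2 ++ be); split=> //; first by rewrite ez; lsolve.
    exact: wpath_cat hal (wpath_cat hQ g1).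
  apply: (eqv_trans (IH (al ++ z1) (z2 ++ Q ++ be) _ (wpath_cat hal g1))); first by rewrite ez; lsolve.
  apply: (swapE (al := al) (p := z1 ++ C ++ z2) (be := be) _ hQ); try by lsolve.
  exact: wpath_cat g1 (wpath_cat hC g2).
- exists (al ++ z1), (z2 ++ P ++ be); split=> //; first by rewrite ez; lsolve.
    exact: wpath_cat hal g1.
  apply: (eqv_trans (IH (al ++ P ++ z1) (z2 ++ be) _ (wpath_cat hal (wpath_cat hP g1)))).
    by rewrite ez; lsolve.
  apply: (swapE (al := al) (q := z1 ++ C ++ z2) (be := be) hP); try by lsolve.
  exact: wpath_cat g1 (wpath_cat hC g2).
- exists (al ++ Q ++ P ++ z1), z2; split=> //; first by rewrite ez; lsolve.
    exact: wpath_cat hal (wpath_cat hQ (wpath_cat hP g1)).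
  apply: (eqv_trans (IH (al ++ P ++ Q ++ z1) z2 _ (wpath_cat hal (wpath_cat hP (wpath_cat hQ g1))))).
    by rewrite ez; lsolve.
  by apply: (swapE (al := al) (be := z1 ++ C ++ z2) hP hQ); lsolve.
Qed.
End Squares.

(** * The length bound for words *)

Section Bound.
Variables (V A : eqType) (tl hd : A -> V).
Implicit Types (x y v t : V) (e g : A) (u w p q c k C al be : seq A).
Notation wpath := (wpath tl hd).
Notation eqv := (eqv tl hd).
Notation prim := (prim tl hd).
Notation nz := (nz tl hd).
Notation verts := (verts hd).

Lemma prim_ends x y al c be v : wpath x (al ++ c ++ be) y -> prim v c ->
  wpath x al v /\ wpath v be y.
Proof.
case/wpathP=> t h1 /wpathP[s h2 h3] /and3P[hn hc _].
case: c hn h2 hc => // a c _ h2 hc; have e := wpath_start h2 hc; subst t.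
by have es := wpath_end hc h2; subst s.
Qed.

Lemma prim_hd_uniq v c : prim v c -> uniq (map hd c).
Proof. by case/and3P=> _ /closed_perm h; rewrite (perm_uniq h). Qed.

(** Each arrow starts at a visited vertex, hence lies in [w] and ends at a visited vertex. *)
Lemma walk_old x y w t d s : wpath x w y -> wpath t d s -> t \in verts x w ->
  (forall g, g \in d -> tl g \in verts x w -> g \in w) -> {subset d <= w}.
Proof.
move=> hw; elim: d t => [|a d IH] t //= /andP[/eqP ha h] ht H.
have haw : a \in w by apply: H; rewrite ?mem_head // ha.
move=> g; rewrite inE => /orP[/eqP->//|]; apply: IH h _ _ g; first exact: hd_verts.
by move=> g hg; apply: H; rewrite inE hg orbT.
Qed.

(* The only arrow of [c] outside [w] with an old tail lies on one of the two arcs of [c] between [v]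
   and [t]; along the other arc [c] can slide. *)
Lemma attach_old x y w al be v c t : w = al ++ be -> wpath x al v -> wpath v be y -> prim v c ->
  count [pred g | (tl g \in verts x w) && (g \notin w)] c = 1 ->
  t \in map tl c -> t \in verts x w ->
  exists c' p q, [/\ w = p ++ q, wpath x p t, wpath t c' t & eqv (al ++ c ++ be) (p ++ c' ++ q)].
Proof.
move=> ew hal hbe hc h1 ht htw; set P := [pred g | _] in h1.
have hw : wpath x w y by rewrite ew; apply: wpath_cat hal hbe.
have [d [f [ec hd1 hf _]]] := prim_rot hc ht.
have [p [q [epq hp hq]]] := vertsE hw htw.
have P0 z : count P z = 0 -> forall g, g \in z -> tl g \in verts x w -> g \in w.
  move=> /eqP; rewrite -leqn0 leqNgt -has_count => /hasPn hz g /hz /= + h.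
  by rewrite h negbK.
exists (f ++ d), p, q; split=> //; first exact: wpath_cat hf hd1.
have hv : v \in verts x w by apply/(vertsP v hw); exists al, be.
rewrite ec; move: h1; rewrite ec count_cat; case E : (count P d) => [|j] /=.
  by move=> _; apply: (slide hw hd1 hf _ ew epq hal hp); apply: (walk_old hw hd1 hv (P0 _ E)).
rewrite addSn => -[] /eqP; rewrite addn_eq0 => /andP[_ /eqP E2].
by apply: eqv_sym; apply: (slide hw hf hd1 _ epq ew hp hal); apply: (walk_old hw hf htw (P0 _ E2)).
Qed.

(* Inserted elsewhere, [C] would leave the square [k ++ k] intact. *)
Lemma attach_square x y w C t p q al k be t0 : wpath x w y -> w = p ++ q -> wpath x p t ->
  wpath t C t -> nz (p ++ C ++ q) -> eqv w (al ++ k ++ k ++ be) -> prim t0 k ->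
  [/\ t \notin verts x al, t \notin verts t0 be
    & exists k1 k2, [/\ k = k1 ++ k2, wpath t0 k1 t & wpath t k2 t0]].
Proof.
move=> hw ew hp hC hn hk pk; have hw' := eqv_wpath hk hw.
have [hal _] := prim_ends hw' pk; have /and3P[kn ck _] := pk.
have hbe : wpath t0 be y.
  by apply: (wpath_catr ck); apply: (wpath_catr ck); apply: (wpath_catr hal).
have no p' q' : al ++ k ++ k ++ be = p' ++ q' -> wpath x p' t ->
    forall a b, p' ++ C ++ q' = a ++ k ++ k ++ b -> False.
  move=> e1 e2 a b e3; case/eqP: kn; apply: (hn a k b t0) => //; rewrite -e3.
  exact: carry hC hw hk ew e1 hp e2.
have n1 : t \notin verts x al.
  apply/negP => /(vertsE hal)[a1 [a2 [ea h1 h2]]].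
  by apply: (no a1 (a2 ++ k ++ k ++ be) _ h1 (a1 ++ C ++ a2) be); rewrite ?ea; lsolve.
have n2 : t \notin verts t0 be.
  apply/negP => /(vertsE hbe)[b1 [b2 [eb h1 h2]]].
  apply: (no (al ++ k ++ k ++ b1) b2 _ _ al (b1 ++ C ++ b2)); rewrite ?eb; try by lsolve.
  exact: wpath_cat hal (wpath_cat ck (wpath_cat ck h1)).
split=> //; apply: (vertsE ck).
have : t \in verts x w by apply/(vertsP t hw); exists p, q; split=> //; apply: (wpath_catr hp); rewrite -ew.
have /perm_mem-> : perm_eq (verts x w) (verts x (al ++ k ++ k ++ be)).
  by rewrite perm_cons; apply: perm_map; exact: eqv_perm hk.
rewrite /Word.verts in n1 n2 *; move: n1 n2; rewrite !inE !map_cat !mem_cat !negb_or.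
by case/andP=> /negbTE-> /negbTE-> /andP[/negbTE-> /negbTE->]; rewrite !orbF /= orbb.
Qed.

Lemma tl_inj k e g : uniq (map tl k) -> e \in k -> g \in k -> tl e = tl g -> e = g.
Proof.
elim: k => //= a k IH /andP[hn hu]; rewrite !inE => /orP[/eqP->|he] /orP[/eqP->|hg] // h.
- by move: hn; rewrite h map_f.
- by move: hn; rewrite -h map_f.
- exact: IH.
Qed.

(* Choose the square with [be] shortest: a further square in [al ++ k ++ be] forces [be] to start
   with the first arrow of [k], and the square can be shifted. *)
Lemma split_square x y w C t p q : wpath x w y -> w = p ++ q -> wpath x p t -> wpath t C t ->
  nz (p ++ C ++ q) -> ~ nz w -> exists al k be t0,
  [/\ eqv w (al ++ k ++ k ++ be), prim t0 k, wpath x al t0, wpath t0 be y & nz (al ++ k ++ be)].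
Proof.
move=> hw ew hp hC hn hw0.
have [] := @nat_min (fun j => exists al k be v, [/\ eqv w (al ++ k ++ k ++ be), prim v k & size be = j]).
  by have [al [k [be [v [h1 h2]]]]] := square_prim hw0; exists (size be), al, k, be, v.
move=> j [al [k [be [t0 [hk pk <-]]]]] hmin; exists al, k, be, t0.
have hw' := eqv_wpath hk hw; have /and3P[kn ck uk] := pk.
have [hal _] := prim_ends hw' pk.
have hbe : wpath t0 be y.
  by apply: (wpath_catr ck); apply: (wpath_catr ck); apply: (wpath_catr hal).
split=> //; apply: NNPP => hu0.
have hu : wpath x (al ++ k ++ be) y by apply: wpath_cat hal (wpath_cat ck hbe).
have [_ _ [k1 [k2 [ek h1 h2]]]] := attach_square hw ew hp hC hn hk pk.
(* The first [k] with [C] inside is a closed word attached to [al ++ k ++ be] at [t0], so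
   [attach_square] applies to the reduced word as well. *)
have hY : wpath t0 (k1 ++ C ++ k2) t0 by apply: wpath_cat h1 (wpath_cat hC h2).
have hnY : nz (al ++ (k1 ++ C ++ k2) ++ (k ++ be)).
  apply: nz_eqv hn; apply: eqv_trans (carry hC hw hk ew _ hp (wpath_cat hal h1)) _.
    by rewrite {1}ek; lsolve.
  by apply: eqvE; lsolve.
have [al' [k' [be' [t' [hk' pk']]]]] := square_prim hu0.
have [n1 n2 [k1' [k2' [ek' h1' h2']]]] := attach_square hu erefl hal hY hnY hk' pk'.
have hu' := eqv_wpath hk' hu; have /and3P[kn' ck' uk'] := pk'.
have [hal' _] := prim_ends hu' pk'.
have hbe' : wpath t' be' y.
  by apply: (wpath_catr ck'); apply: (wpath_catr ck'); apply: (wpath_catr hal').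
(* All arrows leaving [t0] lie in [k'], whose tails are distinct, so only one arrow leaves [t0]. *)
have ink g : g \in al ++ k ++ be -> tl g = t0 -> g \in k'.
  rewrite (perm_mem (eqv_perm hk')) !mem_cat => /or4P[|//|//|] hg eg.
    by case/negP: n1; rewrite -eg; apply: tl_verts hal' hg.
  by case/negP: n2; rewrite -eg; apply: tl_verts hbe' hg.
case: be hbe {hw' hnY hu0} hk hu hk' ink hmin => [|b be] hbe hk hu hk' ink hmin.
  by case/negP: n2; move/eqP: hbe => ->; apply/(vertsP y hbe'); exists be', [::]; rewrite cats0 /= eqxx.
case: k kn {pk} ck uk hk ek hu hk' ink hmin => [//|e k] _ ck uk hk ek hu hk' ink hmin.
have /andP[/eqP te ck0] := ck; have /andP[/eqP tb _] := hbe.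
have eb : b = e.
  by apply: (tl_inj uk'); rewrite ?te //; apply: ink => //; rewrite !mem_cat mem_head ?orbT.
have : size (b :: be) <= size be; last by rewrite ltnn.
apply: hmin; exists (al ++ [:: e]), (k ++ [:: e]), be, (hd e); split=> //.
  by apply: eqv_trans hk _; apply: eqvE; rewrite eb; lsolve.
apply/and3P; split; first by case: (k).
  by apply: wpath_cat ck0 _; rewrite /= te !eqxx.
by rewrite map_cat cats1 rcons_uniq -cons_uniq.
Qed.

Variable m : nat.
Hypothesis hm : forall v c, prim v c -> size c <= m.

(** Induction by removing the cycle of [private_cycle], and then one copy of [k] if the rest is not
    square-free. The term [num_once] is the reserve that pays for the second removal. *)
Theorem path_bound x u y : wpath x u y -> nz u -> ~~ uniq (verts x u) ->
  size u + 1 + num_once (verts x u) + m * num_distinct (verts x u) <= m * num_distinct u + 2 * num_distinct (verts x u).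
Proof.
have [n] := ubnP (size u); elim: n u => // n IH u hsz hu hn hnu.
have [al [c [be [v [e [eu hal hc he he1]]]]]] := private_cycle hu hn hnu.
have [_ hbe] := prim_ends (eqv_wpath eu hu) hc; have /and3P[cn cc uc] := hc.
have hca : uniq c := map_uniq uc; have hch := prim_hd_uniq hc.
set w := al ++ be; have hw : wpath x w y by apply: wpath_cat hal hbe.
have nu : nz (al ++ c ++ be) := nz_eqv eu hn.
have puw : perm_eq u (w ++ c) by apply: (perm_trans (eqv_perm eu)); rewrite -catA perm_cat2l perm_catC.
have pv : perm_eq (verts x u) (verts x w ++ map hd c).
  by rewrite /= perm_cons -map_cat; apply: perm_map.
have hv : v \in verts x w by apply/(vertsP v hw); exists al, be.
have su : size u = size w + size c by rewrite (perm_size puw) size_cat.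
rewrite {}su (num_distinct_perm puw) (num_distinct_perm pv) (num_once_perm pv) (num_distinct_cat _ hca) (num_distinct_cat _ hch).
have H1 := num_once_cat (verts x w) hch.
(* [nu0] counts the new vertices of [c], [k1] those that [w] visits once, and [ep] the arrows of [c]
   outside [w] with an old tail. *)
set nu0 := count [predC verts x w] (map hd c) in H1 *; set k1 := count _ (map hd c) in H1 *.
set ep := count [pred g | (tl g \in verts x w) && (g \notin w)] c.
have -> : count [predC w] c = nu0 + ep.
  rewrite (@count_sum _ _ [pred g | tl g \notin verts x w] [pred g | (tl g \in verts x w) && (g \notin w)]).
    by rewrite /nu0 -(permP (closed_perm cc)) count_map.
  move=> g /=; case hg : (g \in w) => /=; first by rewrite (tl_verts hw hg) andbF.
  by rewrite andbT; case: (tl g \in _).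
have H2 : size c = nu0 + count (mem (verts x w)) (map hd c).
  by rewrite -(size_map hd c) -(count_predC (mem (verts x w))) addnC.
set b := count (mem _) _ in H2.
(* Were [ep] zero, [walk_old] would put [e] into [w], while its only occurrence is in [c]. *)
have H3 : 0 < ep.
  rewrite lt0n; apply/negP => /eqP E; have : e \in w.
    apply: (walk_old hw cc hv _ he) => g hg hgw.
    move/eqP: E; rewrite -leqn0 leqNgt -has_count => /hasPn/(_ _ hg) /=.
    by rewrite hgw /= negbK.
  have : count_mem e c = 1 by rewrite count_uniq_mem // he.
  move: he1; rewrite (permP puw) count_cat -has_pred1 has_count; clia.
have H4 := hm hc.
have H5 : m <= m * ep by rewrite leq_pmulr.
(* Base case: all counts of [w] are lengths. *)
case hs : (uniq (verts x w)).
  have : k1 = b.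
    by apply: eq_count => z; rewrite -[LHS]/(count_mem z (verts x w) == 1) (count_uniq_mem z hs) -[RHS]/(z \in verts x w); case: (z \in verts x w).
  have : num_distinct w = size w by apply: num_distinct_uniq; move: hs => /= /andP[_ /map_uniq].
  move: H1; rewrite (num_once_uniq hs) (num_distinct_uniq hs) /= size_map !mulnDr.
  move: H2 H3 H4 H5; clear; rewrite mulnS; lia.
have lw : size w < n.
  by move: hsz cn; rewrite (perm_size puw) size_cat; case: (c) => //= ? ?; clia.
case: (classic (nz w)) => hnw.
  have := IH w lw hw hnw (negbT hs).
  by move: H1 H2 H3 H4 H5; rewrite !mulnDr; clia.
have [al' [k [be' [t0 [ek pk g1 g2 g3]]]]] := split_square hw erefl hal cc nu hnw.
have pkw := eqv_perm ek; have /and3P[kn ck uk] := pk.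
set w' := al' ++ k ++ be' in g3.
have hw' : wpath x w' y by apply: wpath_cat g1 (wpath_cat ck g2).
have pww : perm_eq w (w' ++ k).
  by apply: (perm_trans pkw); apply/permP => P; rewrite /w'; cnt; clia.
have pvw : perm_eq (verts x w) (verts x w' ++ map hd k).
  by rewrite /= perm_cons -map_cat; apply: perm_map.
have hkh := prim_hd_uniq pk; have hka : uniq k := map_uniq uk.
have lw' : size w' < n.
  by move: lw; rewrite (perm_size pww) size_cat; clia.
have hs' : ~~ uniq (verts x w').
  rewrite (verts_tl hw') /w' !map_cat -cats1 -!catA cats1 -(verts_tl g2) !cat_uniq.
  apply/negP => /and3P[_ _ /and3P[_ /negP hno _]]; apply: hno; apply/hasP; exists t0; first exact: mem_head.
  by case: (k) kn ck => //= g k0 _ /andP[/eqP<- _]; apply: mem_head.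
have := IH w' lw' hw' g3 hs'.
have -> : num_distinct w = num_distinct w'.
  rewrite (num_distinct_perm pww) num_distinct_cat //; set z := count _ _.
  suff -> : z = 0 by rewrite addn0.
  apply/eqP; rewrite -leqn0 leqNgt -has_count; apply/hasPn => g hg /=.
  by rewrite negbK /w' !mem_cat hg orbT.
have H6 := num_once_cat (verts x w') hkh.
have e0 : count [predC verts x w'] (map hd k) = 0.
  apply/eqP; rewrite -leqn0 leqNgt -has_count; apply/hasPn => g hg /=.
  by rewrite negbK /Word.verts inE /w' !map_cat !mem_cat hg !orbT.
rewrite (num_distinct_perm pvw) (num_distinct_cat _ hkh) e0 addn0.
rewrite e0 addn0 -(num_once_perm pvw) in H6.
set kk := count _ (map hd k) in H6.
(* For [ep = 1], [c] can be attached at each of its old vertices [t]. By [attach_square], [t] is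
   visited only inside the square, hence exactly once when one copy of [k] is removed. *)
have H7 : ep = 1 -> b <= kk.
  move=> E; rewrite /b /kk -!size_filter; apply: uniq_leq_size; first exact: filter_uniq.
  move=> t; rewrite !mem_filter /= => /andP[htw htc].
  have htc' : t \in map tl c by rewrite -(closed_hd cc).
  have [c' [p [q [ew hp hc' h1]]]] := attach_old erefl hal hbe hc E htc' htw.
  have [n1 n2 [k1' [k2' [ek' h2 h3]]]] := attach_square hw ew hp hc' (nz_eqv h1 nu) ek pk.
  have htk : t \in map hd k.
    have : t \in verts t0 k by apply/(vertsP t ck); exists k1', k2'.
    rewrite /Word.verts inE => /orP[/eqP et|//]; case/negP: n2; rewrite et; exact: mem_head.
  rewrite htk andbT /w' !map_cat; move: n1 n2; rewrite /Word.verts !inE !negb_or => /andP[n1 n1'] /andP[_ n2].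
  rewrite /= (eq_sym x t) (negbTE n1) !count_cat (count_uniq_mem _ hkh) htk.
  by rewrite (count_memPn n1') (count_memPn n2).
have H8 := hm pk.
have -> : size w = size w' + size k by rewrite (perm_size pww) size_cat.
(* The lengths to cover are [size k] and [b], each at most [m]. For [ep = 1], [kk] pays for [b];
   otherwise a second [m] does. *)
have [h1|h1] : ep = 1 \/ 1 < ep by move: H3; clia.
  have := H7 h1; move: H1 H2 H3 H4 H6 H8; rewrite h1 !mulnDr muln1; clia.
have H9 : m + m <= m * ep by rewrite addnn -mul2n mulnC leq_mul2l h1 orbT.
move: H1 H2 H3 H4 H6 H8 H9; rewrite !mulnDr; clia.
Qed.
End Bound.

(** * From closed paths to words, and the degree bound *)

Section Quivers.
Variables (n d : nat) (Q : quiver n d).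
Implicit Types (v t : 'I_n) (a e : 'I_d) (p q r s u h al be : seq 'I_d).
Notation tl := (qtail Q).
Notation hd := (qhead Q).
Notation wpath := (wpath tl hd).
Notation eqv := (eqv tl hd).
Notation prim := (prim tl hd).
Notation nz := (nz tl hd).
Notation verts := (verts hd).
Local Notation "p ~~~ q" := (qequiv Q (Some p) q) (at level 70).

Lemma wpath_last a s v : wpath (hd a) s v =
  path (fun x y => hd x == tl y) a s && (hd (last a s) == v).
Proof. by elim: s a => //= b s IH a; rewrite IH eq_sym andbA. Qed.

Lemma qpathE p t v : wpath t p v -> p != [::] -> is_qpath Q p.
Proof. by case: p => //= a s /andP[_]; rewrite wpath_last => /andP[]. Qed.

Lemma closedE p v : wpath v p v -> p != [::] -> is_closed_path Q p.
Proof.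
by case: p => //= a s /andP[/eqP->]; rewrite wpath_last => /andP[-> /eqP->]; rewrite eqxx.
Qed.

Lemma closed_inv p : is_closed_path Q p -> p != [::] /\ exists v, wpath v p v.
Proof.
case: p => //= a s /andP[h1 h2]; split=> //; exists (tl a).
by rewrite eqxx wpath_last h1 eq_sym.
Qed.

Lemma incidentE p q v : wpath v p v -> wpath v q v -> p != [::] -> q != [::] -> incident Q p q.
Proof. by case: p => //= a p /andP[/eqP-> _]; case: q => //= b q /andP[/eqP-> _]; rewrite eqxx. Qed.

Lemma qequiv_rot p q v t : wpath v p t -> wpath t q v -> p ++ q ~~~ Some (q ++ p).
Proof.
move=> hp hq; case: (altP (p =P [::])) => [->|np]; first by rewrite cats0; apply: rst_refl.
case: (altP (q =P [::])) => [->|nq]; first by rewrite cats0; apply: rst_refl.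
apply: rst_step; apply: eg_rot; [exact: qpathE hp np | exact: qpathE hq nq|].
by apply: (closedE (wpath_cat hp hq)); case: (p) np.
Qed.

Lemma qequiv_swap p q r v : wpath v p v -> wpath v q v -> wpath v r v ->
  p ++ q ++ r ~~~ Some (q ++ p ++ r).
Proof.
move=> hp hq hr; case: (altP (p =P [::])) => [->|np]; first exact: rst_refl.
case: (altP (q =P [::])) => [->|nq]; first exact: rst_refl.
case: (altP (r =P [::])) => [->|nr].
  rewrite !cats0; exact: qequiv_rot hp hq.
apply: rst_step; have := @eg_perm n d Q [:: q; p; r] [:: p; q; r]; rewrite /= !cats0; apply=> //.
- by rewrite (closedE hp) // (closedE hq) // (closedE hr).
- have H s : s \in [:: q; p; r] -> wpath v s v /\ s != [::].
    by rewrite !inE => /or3P[] /eqP->.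
  by move=> s s' /H[h1 h2] /H[h3 h4]; apply: incidentE h1 h3 h2 h4.
- exact: (permEl (perm_catCA [:: q] [:: p] [:: r])).
Qed.

(** A rotation brings [p ++ q] to the front; the rest [be ++ al] is then a third closed path at the
    same vertex. *)
Lemma eqv_qequiv u w v : wpath v u v -> eqv u w -> u ~~~ Some w.
Proof.
move=> hu; elim=> [|v0 al p q be h IH hp hq]; first exact: rst_refl.
apply: rst_trans IH _.
case: (altP (p =P [::])) => [->|np]; first exact: rst_refl.
have h1 := eqv_wpath h hu; case/wpathP: h1 => t h1 /wpathP[t1 h2 h3].
have et : t = v0 by case: (p) np hp h2 => // a s _ h4 h5; apply: wpath_start h5 h4.
subst t; have h4 := wpath_catr hq (wpath_catr hp (wpath_cat h2 h3)).
have hr : wpath v0 (be ++ al) v0 by apply: wpath_cat h4 h1.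
apply: rst_trans (qequiv_rot h1 (wpath_cat hp (wpath_cat hq h4))) _.
rewrite -!catA; apply: rst_trans (qequiv_swap hp hq hr) _.
apply: rst_sym; have := qequiv_rot h1 (wpath_cat hq (wpath_cat hp h4)); by rewrite -!catA.
Qed.

Lemma nonzero_nz h v : wpath v h v -> ~ h ~~~ None -> nz h.
Proof.
move=> hh h0 al p be t he hp; apply/eqP/negPn/negP => np; apply: h0.
apply: rst_trans (eqv_qequiv hh he) _.
have h1 := eqv_wpath he hh; case/wpathP: h1 => t1 h1 /wpathP[t2 h2 h3].
have et : t1 = t by case: (p) np hp h2 => // a s _ h4 h5; apply: wpath_start h5 h4.
subst t1; have h4 := wpath_catr hp (wpath_catr hp (wpath_cat h2 h3)).
have hr : wpath t (be ++ al) t by apply: wpath_cat h4 h1.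
apply: rst_trans (qequiv_rot h1 (wpath_cat hp (wpath_cat hp h4))) _.
rewrite -!catA; case: (altP (be ++ al =P [::])) => [->|nr].
  by rewrite cats0; apply: rst_step; apply: eg_sq; apply: closedE hp np.
apply: rst_step; apply: eg_sq2; [exact: closedE hp np | exact: closedE hr nr | exact: incidentE hp hr np nr].
Qed.

Lemma prim_primitive v c : prim v c -> is_primitive Q c.
Proof.
move=> hc; case/and3P: (hc) => cn hcc _; rewrite /is_primitive (closedE hcc cn) /=.
have uh := prim_hd_uniq hc; apply/allP => t ht.
rewrite (eq_count (a2 := preim hd (pred1 t))) // -count_map count_uniq_mem //.
suff -> : t \in map hd c by [].
move: ht; case E : (c) => [//|a s]; rewrite inE -E => /orP[/eqP->|//].
by rewrite (closed_hd hcc) map_f // E mem_head.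
Qed.

Lemma primitive_size p : is_primitive Q p -> size p <= n.
Proof.
case/andP=> /closed_inv[np [v hp]] /allP h.
have : uniq (map hd p).
  apply: count_mem_uniq => t; case ht : (t \in map hd p); last by apply/count_memPn; rewrite ht.
  by rewrite count_map; apply/eqP; apply: h; case: (p) ht => // a s ht; rewrite in_cons ht orbT.
move/card_uniqP; rewrite size_map => <-; apply: leq_trans (max_card _) _; by rewrite card_ord.
Qed.

Hypothesis hQ : strongly_connected Q.

Lemma has_out v : exists a, tl a = v.
Proof.
case: hQ => p [/closed_inv[np [t hp]] /(_ v) hv].
suff : v \in map tl p by case/mapP=> a _ ->; exists a.
rewrite -(closed_hd hp); move: hv; case E : (p) => [//|a s]; rewrite inE -E => /orP[/eqP->|//].
by rewrite (closed_hd hp) map_f // E mem_head.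
Qed.

(** By strong connectivity an arrow leaves each vertex outside [X], and this arrow is not in [B]. *)
Lemma num_arrows (X : seq 'I_n) (B : seq 'I_d) : uniq B -> (forall a, a \in B -> tl a \in X) ->
  size B + n <= d + num_distinct X.
Proof.
move=> uB hB; set F := [seq a <- enum 'I_d | tl a \notin X].
have h1 : size (enum 'I_n) <= size (undup X ++ map tl F).
  apply: uniq_leq_size (enum_uniq _) _ => t _; rewrite mem_cat mem_undup.
  case ht : (t \in X) => //=; have [a ea] := has_out t.
  by rewrite -ea map_f // mem_filter ea ht mem_enum.
have h2 : size (B ++ F) <= size (enum 'I_d).
  apply: uniq_leq_size => [|a _]; last by rewrite mem_enum.
  rewrite cat_uniq uB filter_uniq ?enum_uniq // andbT; apply/hasPn => a.
  by rewrite mem_filter => /andP[+ _]; apply: contra; apply: hB.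
move: h1 h2; rewrite !size_cat (size_map tl) !size_enum_ord /num_distinct; clia.
Qed.

Lemma num_distinct_ord (X : seq 'I_n) : num_distinct X <= n.
Proof.
rewrite -[leqRHS](size_enum_ord n) /num_distinct; apply: uniq_leq_size (undup_uniq _) _ => t; by rewrite mem_enum.
Qed.

Variable m : nat.
Hypothesis hm : mQ_is Q m.

Lemma degree_bound h : is_closed_path Q h -> ~ h ~~~ None -> size h + m + m * n <= m * d + 2 * n.
Proof.
case/closed_inv=> nh [v hh] h0; have hmax t c : prim t c -> size c <= m.
  by move=> /prim_primitive; case: hm => _; apply.
have hn := nonzero_nz hh h0.
have [_ [c [_ [_ [e [_ _ _ _ he]]]]]] := private_cycle hh hn (closed_nonuniq hh nh).
have /splitS[h1 [h2 eh]] : e \in h by rewrite -has_pred1 has_count he.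
have [g1 g2] : wpath v h1 (tl e) /\ wpath (hd e) h2 v by apply: wpath_mid; rewrite -eh.
have g3 : wpath (tl e) (e :: h2) v by rewrite /= eqxx.
set u := h2 ++ h1; have hu : wpath (hd e) u (tl e) by apply: wpath_cat g2 g1.
have heu : wpath (tl e) (e :: u) (tl e) by rewrite /= eqxx.
have nu : nz u.
  apply: (@nz_sub _ _ tl hd [:: e] u [::]); rewrite cats0; apply: (nonzero_nz heu) => hz.
  apply: h0; apply: rst_trans hz; rewrite eh; exact: (qequiv_rot g1 g3).
have eu : e \notin u.
  apply/count_memPn; move: he; rewrite eh count_cat /= eqxx /u count_cat; clia.
have sh : size h = (size u).+1 by rewrite eh /u !size_cat /= addnS addnC.
(* If [u] repeats no vertex, [e :: u] is primitive, so its length is at most [n], and [m <= n <= d]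
   gives the bound. *)
case hs : (uniq (verts (hd e) u)).
  have pe : prim (tl e) (e :: u).
    apply/and3P; split=> //; move: hs; rewrite (verts_tl hu); by rewrite rcons_uniq.
  have k1 := primitive_size (prim_primitive pe).
  have k2 : m <= n by case: hm => -[p [hp <-]] _; apply: primitive_size.
  have k3 : n <= d.
    by have := @num_arrows [::] [::] isT; rewrite /= addn0 add0n; apply.
  have : m * n <= m * d by rewrite leq_mul2l k3 orbT.
  by move: k1 k2; rewrite sh /=; clia.
have H := path_bound hmax hu nu (negbT hs).
(* [e] is one arrow more on the vertices of [u], which accounts for the summand [m]; its letter is
   the 1 in [path_bound]. *)
have H1 : size (e :: undup u) + n <= d + num_distinct (verts (hd e) u).
  apply: num_arrows => [|a]; first by rewrite /= mem_undup eu undup_uniq.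
  rewrite inE mem_undup => /orP[/eqP->|]; last exact: tl_verts hu.
  by apply/(vertsP _ hu); exists u, [::]; rewrite cats0 /= eqxx.
have H2 := num_distinct_ord (verts (hd e) u).
have H3 : m * (num_distinct u).+1 + m * n <= m * d + m * num_distinct (verts (hd e) u).
  by rewrite -!mulnDr leq_mul2l H1 orbT.
by move: H H2 H3; rewrite sh mulnS; clia.
Qed.
End Quivers.

Import GRing.Theory Num.Theory.
Local Open Scope ring_scope.

Theorem theorem5p1 (K : fieldType) (hKinf : infinite_type K)
  (hchar : (2 \in [pchar K])%N)
  (n d m : nat) (Q : quiver n d) (hQ : in_Qndm Q m)
  (h : seq 'I_d) (hcl : is_closed_path Q h) (hnz : ~ qequiv Q (Some h) None) :
  ((qdeg h)%:Z <= (m%:Z) * (d%:Z - n%:Z - 1) + 2 * n%:Z)%R.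
Proof.
case: hQ => hs hm; have := degree_bound hs hm hcl hnz; rewrite /qdeg; clear; lia.
Qed.
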